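(* Let $T$ and $U$ be two oriented virtual tangles, with components $T_1,\ldots,T_n$ and $U_1,\ldots,U_m$ and associated variables $t_1,\ldots,t_n$ and $u_1,\ldots,u_m$ respectively, such that the connected sum $T\#U$ is well-defined, and such that neither $T$ nor $U$ contains a long component whose two ends both lie on the same boundary side (i.e. there are no ''cups'' or ''caps''). Assume that in the connected sum each long component $T_i$ of $T$ is glued to the long component $U_{\sigma(i)}$ of $U$, for the appropriate bijection $\sigma$ from the indices of long components of $T$ to the indices of long components of $U$. Then $$W_{sc,T\#U}=W_{sc,T}+W_{sc,U}\in \mathbb{Z}[t_1^{\pm1},\ldots,t_n^{\pm1},u_1^{\pm1},\ldots,u_m^{\pm1}]/R,$$ where $R$ is the set of relations $\{t_i=u_{\sigma(i)}\}$, $i$ ranging over the indices of long components of $T$.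
   Context: **Virtual tangles.** A virtual tangle diagram is a generic immersion in a square of finitely many circles (closed components) and arcs (long components), with the ends of the arcs at fixed distinguished points on the top and bottom sides of the square, in which every double point is marked as a classical crossing (with over/under information) or a virtual crossing. Closed components may be present. All tangles are oriented (each component is oriented) and their components are ordered. A virtual tangle is an equivalence class of diagrams up to planar isotopy fixing endpoints, the classical Reidemeister moves R1, R2, R3, and the virtual Reidemeister moves (the analogues of R1, R2, R3 with all crossings virtual, and the mixed move in which a strand with two consecutive virtual crossings is moved across a classical crossing). Each classical crossing $c$ has a sign $sgn(c)=\pm1$ in the usual way. **Connected sum.** $T\#U$ is the tangle obtained by stacking $T$ above $U$, gluing the bottom endpoints of $T$ to the top endpoints of $U$; it is well-defined only if $T$ has as many bottom endpoints as $U$ has top endpoints and the orientations match at the glued points. Closed components of $T$ and $U$ are not glued to anything and become components of $T\#U$. The component of $T\#U$ formed by gluing $T_i$ to $U_{\sigma(i)}$ is assigned the variable $t_i=u_{\sigma(i)}$; closed components keep their own variables. **Wriggle number.** For an ordered pair $(L_1,L_2)$ of components of an oriented virtual diagram, $vlk(L_1,L_2)=\sum_{d} sgn(d)$, summed over classical crossings $d$ where $L_1$ goes over $L_2$. The wriggle number is $W(L_1,L_2)=vlk(L_1,L_2)-vlk(L_2,L_1)$. **Smoothing.** A self-crossing of $T_i$ is a classical crossing both of whose strands belong to $T_i$. The oriented smoothing at $c$ joins the incoming understrand to the outgoing overstrand and the incoming overstrand to the outgoing understrand. Smoothing $T_i$ at a self-crossing $c$ gives a two-component object $L_c$ with inherited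 orientation (all other components of $T$, and all crossings with them, are ignored). Component one of $L_c$ is the component containing the incoming understrand at $c$, and component two is the other. $W(L_c)$ denotes the wriggle number of (component one, component two). **Self-crossing wriggle polynomial.** For a tangle $T$ with components $T_1,\ldots,T_n$ and a variable $t_i$ assigned to each $T_i$, $$W_{sc,T}(t_1,\ldots,t_n)=\sum_{i}\ \sum_{c} sgn(c)\,\bigl(t_i^{W(L_c)}-1\bigr),$$ where the inner sum is over all self-crossings $c$ of $T_i$. It is a Laurent polynomial and is an invariant of oriented virtual tangles with ordered components. *)

(* Defs.v *)
From HB Require Import structures.
From Stdlib Require Import Relation_Operators.
From mathcomp Require Import all_boot all_order all_algebra.
From mathcomp Require Import fraction mpoly.

Set Implicit Arguments.
Unset Strict Implicit.
Unset Printing Implicit Defensive.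

Import GRing.Theory.
Local Open Scope ring_scope.

(** * Virtual tangle diagrams

    A diagram is a generic immersion in the square, put in general position
    with respect to the height function and read from top to bottom: a sequence
    of layers, each with a single elementary tile (a local maximum, a local
    minimum or a double point) with only vertical strands to its left and right.
    Strands at a given height are numbered from 0, from left to right.
    Planar isotopies between such diagrams are generated by the moves
    [exchange] to [slide_cap] below. *)

(** A strand crossing a horizontal line: [true] if it is oriented downwards,
    and the index of the component it belongs to. *)
Definition strand (C : Type) : Type := (bool * C)%type.

Definition opp_strand (C : Type) (s : strand C) : strand C := (~~ s.1, s.2).

(** [Classical true]: the strand running from the upper left to the lower right
    goes over the other one; [Classical false]: it goes under. *)
Inductive crossing_kind : Type := Classical of bool | Virtual.

Definition mirror (x : crossing_kind) : crossing_kind :=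
  if x is Classical b then Classical (~~ b) else Virtual.

(** [Cap s] is a local maximum whose left leg is the strand [s]; [Cup] is a
    local minimum. *)
Inductive tile (C : Type) : Type :=
  | Cap of strand C
  | Cup
  | Cross of crossing_kind.
Arguments Cup {C}.
Arguments Cross {C} _.

(** Numbers of strands above and below a tile. *)
Definition ntop (C : Type) (t : tile C) : nat := if t is Cap _ then 0%N else 2%N.
Definition nbot (C : Type) (t : tile C) : nat := if t is Cup then 0%N else 2%N.

(** The number is that of strands to the left of the tile. *)
Definition layer (C : Type) : Type := (nat * tile C)%type.

Definition tile_out (C : eqType) (t : tile C) (s : seq (strand C)) :
    option (seq (strand C)) :=
  match t, s with
  | Cap a, [::] => Some [:: a; opp_strand a]
  | Cup, [:: a; b] => if b == opp_strand a then Some [::] else None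
  | Cross _, [:: a; b] => Some [:: b; a]
  | _, _ => None
  end.

Definition layer_out (C : eqType) (l : layer C) (s : seq (strand C)) :
    option (seq (strand C)) :=
  let: (i, t) := l in
  if (i + ntop t <= size s)%N then
    omap (fun o => take i s ++ o ++ drop (i + ntop t) s)
         (tile_out t (take (ntop t) (drop i s)))
  else None.

(** The strands below [w] when those above are [s]; [None] if some layer cannot
    be glued to the previous ones. *)
Definition run (C : eqType) (s : seq (strand C)) (w : seq (layer C)) :
    option (seq (strand C)) :=
  foldl (fun o l => obind (layer_out l) o) (Some s) w.

Record diagram (C : Type) : Type := Diagram {
  dtop : seq (strand C);
  dword : seq (layer C);
  dbot : seq (strand C)
}.

(** Endpoints of layers: [(k, j)] is strand [j] on the horizontal line above
    layer [k], i.e. below layer [k - 1]. *)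
Definition point : Type := (nat * nat)%type.

Definition strands_at (C : eqType) (D : diagram C) (k : nat) : seq (strand C) :=
  odflt [::] (run (dtop D) (take k (dword D))).

Definition points (C : eqType) (D : diagram C) : seq point :=
  [seq (k, j) | k <- iota 0 (size (dword D)).+1,
                j <- iota 0 (size (strands_at D k))].

Definition component_at (C : eqType) (D : diagram C) (p : point) : option C :=
  onth (unzip2 (strands_at D p.1)) p.2.

(** ** Classical crossings *)

Record crossing (C : Type) : Type := Crossing {
  height : nat;
  over_in : point;
  over_out : point;
  under_in : point;
  under_out : point;
  over_component : C;
  under_component : C;
  sgn : int
}.

(** The crossing in layer [k], with [a] and [b] the strands above it, on the
    left and on the right. The sign is that of the determinant of the directions
    of the over and under strands: when both strands are oriented downwards,
    these are (1, -1) and (-1, -1) if [left_over]. *)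
Definition mk_crossing (C : Type) (k i : nat) (left_over : bool)
    (a b : strand C) : crossing C :=
  let oriented (s : strand C) (upper lower : point) :=
    if s.1 then (upper, lower) else (lower, upper) in
  let left_strand := oriented a (k, i) (k.+1, i.+1) in
  let right_strand := oriented b (k, i.+1) (k.+1, i) in
  let s : int :=
    (if left_over then -1 else 1) * (if a.1 == b.1 then 1 else -1) in
  if left_over then
    Crossing k left_strand.1 left_strand.2 right_strand.1 right_strand.2
             a.2 b.2 s
  else
    Crossing k right_strand.1 right_strand.2 left_strand.1 left_strand.2
             b.2 a.2 s.

Definition crossing_in_layer (C : eqType) (D : diagram C) (k : nat) :
    option (crossing C) :=
  if onth (dword D) k is Some (i, Cross (Classical left_over)) then
    if drop i (strands_at D k) is a :: b :: _
    then Some (mk_crossing k i left_over a b) else None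
  else None.

Definition crossings (C : eqType) (D : diagram C) : seq (crossing C) :=
  pmap (crossing_in_layer D) (iota 0 (size (dword D))).

(** ** Connectedness and smoothing *)

(** The pairs of points joined by an arc in layer [k], away from its tile. *)
Definition through_arcs (C : Type) (k width : nat) (l : layer C) :
    seq (point * point) :=
  let: (i, t) := l in
  [seq ((k, j), (k.+1, j)) | j <- iota 0 i] ++
  [seq ((k, j), (k.+1, (j - ntop t + nbot t)%N))
     | j <- iota (i + ntop t) (width - (i + ntop t))].

Definition tile_arcs (C : Type) (k : nat) (l : layer C) : seq (point * point) :=
  let: (i, t) := l in
  match t with
  | Cap _ => [:: ((k.+1, i), (k.+1, i.+1))]
  | Cup => [:: ((k, i), (k, i.+1))]
  | Cross _ => [:: ((k, i), (k.+1, i.+1)); ((k, i.+1), (k.+1, i))]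
  end.

(** The arcs of [D] if [c] is [None], and of [D] with the oriented smoothing
    at [c0] if [c] is [Some c0]. *)
Definition arcs (C : eqType) (D : diagram C) (c : option (crossing C)) :
    seq (point * point) :=
  flatten
    [seq through_arcs kl.1 (size (strands_at D kl.1)) kl.2 ++
         (if c is Some c0 then
            if height c0 == kl.1
            then [:: (under_in c0, over_out c0); (over_in c0, under_out c0)]
            else tile_arcs kl.1 kl.2
          else tile_arcs kl.1 kl.2)
       | kl <- zip (iota 0 (size (dword D))) (dword D)].

(** [x] and [y] are in the same connected component of the undirected graph
    with edges [E]. *)
Definition joined (T : choiceType) (E : seq (T * T)) (x y : T) : bool :=
  let V := x :: y :: unzip1 E ++ unzip2 E in
  let adjacent (a b : seq_sub V) :=
    ((val a, val b) \in E) || ((val b, val a) \in E) in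
  [exists p : seq_sub V, exists q : seq_sub V,
    [&& val p == x, val q == y & connect adjacent p q]].

(** The layers fit together, and the components of the immersed curve are
    exactly the [T_i] for [i : C]. *)
Definition is_tangle_diagram (C : finType) (D : diagram C) : Prop :=
  [/\ run (dtop D) (dword D) = Some (dbot D),
      forall i : C, exists2 p, p \in points D & component_at D p = Some i
    & forall p q : point, p \in points D -> q \in points D ->
        component_at D p = component_at D q -> joined (arcs D None) p q].

(** * Virtual tangles *)

(** The admissible third Reidemeister moves, for strands numbered 1, 2, 3 from
    left to right at the top and kinds [x], [y], [z] of the crossings of
    1 and 2, of 1 and 3, of 2 and 3. Three classical crossings must come from
    three strands at different heights; otherwise one strand must have two
    virtual crossings. *)
Definition R3_admissible (x y z : crossing_kind) : bool :=
  match x, y, z with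
  | Classical a, Classical b, Classical c => (a == b) || (b == c)
  | Virtual, Virtual, _ | Virtual, _, Virtual | _, Virtual, Virtual => true
  | _, _, _ => false
  end.

(** Local moves; [R1_cup] to [R3] include the virtual and mixed ones. Moving a
    local extremum across a strand turns a crossing by a quarter turn, whence
    the [mirror] in the slides; [R2] has it because the upper left strand of the
    first crossing is the upper right one of the second. *)
Inductive local_move (C : Type) : seq (layer C) -> seq (layer C) -> Prop :=
  | exchange i j a b : (i + nbot a <= j)%N ->
      local_move [:: (i, a); (j, b)]
                 [:: ((j - nbot a + ntop a)%N, b); (i, a)]
  | zigzag_left i s :
      local_move [:: (i, Cap s); (i.+1, Cup)] [::]
  | zigzag_right i s :
      local_move [:: (i.+1, Cap s); (i, Cup)] [::]
  | slide_cup i x :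
      local_move [:: (i, Cross x); (i.+1, Cup)]
                 [:: (i.+1, Cross (mirror x)); (i, Cup)]
  | slide_cap i s x :
      local_move [:: (i, Cap s); (i.+1, Cross x)]
                 [:: (i.+1, Cap s); (i, Cross (mirror x))]
  | R1_cup i x :
      local_move [:: (i, Cross x); (i, Cup)] [:: (i, Cup)]
  | R1_cap i s x :
      local_move [:: (i, Cap s); (i, Cross x)] [:: (i, Cap (opp_strand s))]
  | R2 i x :
      local_move [:: (i, Cross x); (i, Cross (mirror x))] [::]
  | R3 i x y z : R3_admissible x y z ->
      local_move [:: (i, Cross x); (i.+1, Cross y); (i, Cross z)]
                 [:: (i.+1, Cross z); (i, Cross y); (i.+1, Cross x)].

Definition move (C : finType) (D E : diagram C) : Prop :=
  [/\ is_tangle_diagram D, is_tangle_diagram E,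
      dtop D = dtop E, dbot D = dbot E
    & exists u l r v, [/\ local_move l r,
        dword D = u ++ l ++ v & dword E = u ++ r ++ v]].

(** [D] and [E] are diagrams of the same virtual tangle. *)
Definition same_tangle (C : finType) : diagram C -> diagram C -> Prop :=
  clos_refl_sym_trans _ (@move C).

(** * The self-crossing wriggle polynomial *)

(** [X] is the set of crossings that are taken into account; components are
    given by the points on them. *)
Definition vlk (C : Type) (X : seq (crossing C)) (L1 L2 : pred point) : int :=
  \sum_(d <- X | L1 (over_in d) && L2 (under_in d)) sgn d.

Definition wriggle (C : Type) (X : seq (crossing C)) (L1 L2 : pred point) : int :=
  vlk X L1 L2 - vlk X L2 L1.

(** [W(L_c)]. Crossings with other components of the diagram do not lie on both
    components of [L_c], hence do not contribute. *)
Definition smoothing_wriggle (C : eqType) (D : diagram C) (c : crossing C) : int :=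
  let component_one := joined (arcs D (Some c)) (under_in c) in
  let component_two := joined (arcs D (Some c)) (over_in c) in
  wriggle [seq d <- crossings D | height d != height c]
          component_one component_two.

(** The value of the polynomial when the component [i] has variable [x i]. *)
Definition Wsc (C : finType) (F : fieldType) (D : diagram C) (x : C -> F) : F :=
  \sum_(i : C)
    \sum_(c <- crossings D | (over_component c == i) && (under_component c == i))
      (sgn c)%:~R * (x i ^ smoothing_wriggle D c - 1).

(** * Connected sums *)

Definition long (C : eqType) (D : diagram C) : pred C :=
  fun i => i \in unzip2 (dtop D ++ dbot D).

(** No component has two ends on the same side. *)
Definition no_cups_or_caps (C : eqType) (D : diagram C) : Prop :=
  uniq (unzip2 (dtop D)) /\ uniq (unzip2 (dbot D)).

(** [T] has as many bottom endpoints as [U] has top ones, and orientations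
    match. *)
Definition csum_well_defined (C C' : Type) (T : diagram C) (U : diagram C') : Prop :=
  unzip1 (dbot T) = unzip1 (dtop U).

Definition glued (C C' : eqType) (T : diagram C) (U : diagram C') (i : C) (j : C') :
    bool :=
  (i, j) \in zip (unzip2 (dbot T)) (unzip2 (dtop U)).

Definition relabel_strand (C C' : Type) (f : C -> C') (s : strand C) : strand C' :=
  (s.1, f s.2).

Definition relabel_layer (C C' : Type) (f : C -> C') (l : layer C) : layer C' :=
  (l.1, match l.2 with
        | Cap s => Cap (relabel_strand f s)
        | Cup => Cup
        | Cross x => Cross x
        end).

(** The components of [T # U]: the closed components of [T], the closed
    components of [U], and for each long component [j] of [U] the component
    formed by gluing it to the [i] such that [sigma i = j]. *)
Definition csum_component (C C' : finType) (T : diagram C) : finType :=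
  ({i : C | ~~ long T i} + C')%type.
Arguments csum_component {C} C' T.

Definition csum_component_l (C C' : finType) (T : diagram C) (U : diagram C')
    (sigma : {i : C | long T i} -> {j : C' | long U j}) (i : C) :
    csum_component C' T :=
  match @boolP (long T i) with
  | AltTrue long_i => inr (val (sigma (Sub i long_i)))
  | AltFalse closed_i => inl (Sub i closed_i)
  end.

Definition csum_component_r (C C' : finType) (T : diagram C) (j : C') :
    csum_component C' T := inr j.

(** [T] is stacked above [U]. *)
Definition csum (C C' : finType) (T : diagram C) (U : diagram C')
    (sigma : {i : C | long T i} -> {j : C' | long U j}) :
    diagram (csum_component C' T) :=
  Diagram (map (relabel_strand (csum_component_l sigma)) (dtop T))
          (map (relabel_layer (csum_component_l sigma)) (dword T) ++
           map (relabel_layer (csum_component_r T)) (dword U))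
          (map (relabel_strand (csum_component_r T)) (dbot U)).

(** The component formed by gluing [T_i] and [U_(sigma i)] has the variable
    [t_i = u_(sigma i)], for which the representative [u_(sigma i)] is used. *)
Definition csum_variable (C C' : finType) (T : diagram C) (F : Type)
    (t : C -> F) (u : C' -> F) (c : csum_component C' T) : F :=
  match c with
  | inl i => t (val i)
  | inr j => u j
  end.

(** * Laurent polynomials modulo the relations *)

(** Laurent polynomials in [N] variables are represented in the field of
    fractions of the polynomial ring. *)
Definition fraction_field (N : nat) : fieldType := {fraction {mpoly int[N]}}.

Definition is_laurent (N : nat) (f : fraction_field N) : Prop :=
  exists (p : {mpoly int[N]}) (m : 'X_{1..N}), f = tofrac p / tofrac 'X_[m].

Definition tvar (n m : nat) (i : 'I_n) : fraction_field (n + m) :=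
  tofrac 'X_(lshift m i).

Definition uvar (n m : nat) (j : 'I_m) : fraction_field (n + m) :=
  tofrac 'X_(rshift n j).
Arguments tvar {n m} i.
Arguments uvar {n m} j.

(** [f] and [g] are Laurent polynomials with the same image in
    [Z[t_i^{+-1}, u_j^{+-1}] / (t_i = u_(sigma i))]. *)
Definition eq_mod_relations (n m : nat) (P : pred 'I_n) (Q : pred 'I_m)
    (sigma : {i | P i} -> {j | Q j}) (f g : fraction_field (n + m)) : Prop :=
  [/\ is_laurent f, is_laurent g
    & exists a : {i | P i} -> fraction_field (n + m),
        (forall i, is_laurent (a i)) /\
        f - g = \sum_i a i * (tvar (val i) - uvar (val (sigma i)))].

(* Main.v *)
Require Import Defs.
From mathcomp Require Import all_boot all_order all_algebra.
From mathcomp Require Import fraction mpoly ring zify.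

Set Implicit Arguments.
Unset Strict Implicit.
Unset Printing Implicit Defensive.

Import GRing.Theory.
Local Open Scope ring_scope.

(** The index of a crossing. Let [c] be a self-crossing of the component [i], and
    let [F] be a boolean function on points, a colouring, which is constant along
    the arcs of the smoothing at [c], with value [true] at the incoming
    understrand and [false] at the incoming overstrand. A point of [i] is joined
    in the smoothing to one of these two strands, because the points that are
    form a union of components of the diagram itself. So [F] is on [i] the
    indicator function of component one of [L_c], and W(L_c) is the sum, over
    the classical self-crossings [d] of [i] other than [c], of sgn(d) times the
    difference of the values of [F] on the over and on the under strand of [d]
    ([smoothing_wriggleE]). Any colouring will do. If there is none, components
    one and two coincide and the contribution of [c] to the polynomial is 0
    ([colouring_of_crossing_term]).

    Locality. On the unsmoothed diagram, [F] is constant along arcs except at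
    [c], where both strands change colour. A colouring can thus be read from top
    to bottom, one layer after the other, and its weight is a sum over layers:
    [word_step] is the relation between the colours above and below a word, with
    the weight, and it is compatible with concatenation. At a crossing of two
    strands of [i] the weight is the intersection number [pairing] of the two
    coloured strands, which is antisymmetric, changes sign when one strand is
    reversed, and does not involve over and under.

    Invariance. For every local move, the two sides define the same relation,
    without marked crossing and with a corresponding crossing marked on both
    sides ([slide_cup_equiv], [R2_marked_equiv], [R3_marked1] and the like). For
    the slides this is a quarter turn of a crossing; for the third Reidemeister
    moves it is the identity [marked_pairing] between the pairings of a strand
    with the two strands of a marked crossing. The crossing of a kink has a
    colouring of weight 0, hence no contribution, and the contributions of the
    two crossings of a bigon cancel. This gives [Wsc_same_tangle].

    Additivity. A colouring for a crossing of [T] extends to [T # U] by giving to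
    each component of [U] the colour of the bottom end of [T] to which it is
    glued, which is possible because no two of these ends belong to the same
    component. Such an extension has no weight on [U], where every component has
    a single colour. Hence a crossing has the same index in [T # U] as in [T], or
    in [U], and the polynomial of [T # U] is the sum of those of [T] and [U] with
    the variables of the sum ([Wsc_csum]). Replacing [t_i] by [u_(sigma i)] in
    the polynomial of [T] changes it by an element of the ideal of the relations,
    since [t - u] divides [t ^ w - u ^ w] among Laurent polynomials. *)

(** * Connectedness through boolean functions *)

Definition respects (T : Type) (f : T -> bool) (E : seq (T * T)) : bool :=
  all (fun e => f e.1 == f e.2) E.

(** A connected component is the intersection of all sets of points that are
    unions of components, so connectedness can be tested with functions that are
    constant along edges. Every path argument below is replaced by the choice of
    such a function. *)
Lemma joinedP (T : choiceType) (E : seq (T * T)) (x y : T) :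
  reflect (forall f : T -> bool, respects f E -> f x = f y) (joined E x y).
Proof.
rewrite /joined; set V := _ :: _ :: _; set adj := fun _ _ => _ || _.
apply: (iffP idP) => [/existsP[p /existsP[q /and3P[/eqP px /eqP qy pq]]] f fE|xy].
  rewrite -px -qy -[f (val p)]/(p \in [pred r | f (val r)]).
  rewrite -[f (val q)]/(q \in [pred r | f (val r)]).
  apply: closed_connect pq => a b /= ab; rewrite !inE.
  by case/orP: ab => /(allP fE)/= /eqP.
have xV : x \in V by rewrite inE eqxx.
pose p0 : seq_sub V := SeqSub xV.
(* [f] is the indicator function of the component of [x]. *)
pose f z := [exists q : seq_sub V, (val q == z) && connect adj p0 q].
have fx : f x by apply/existsP; exists p0; rewrite eqxx connect0.
suff fE : respects f E.
  move: (xy f fE); rewrite fx => /esym /existsP[q /andP[qy p0q]].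
  by apply/existsP; exists p0; apply/existsP; exists q; rewrite eqxx qy.
apply/allP => -[a b] ab /=.
have aV : a \in V.
  by rewrite !inE mem_cat; apply/or3P/Or33/orP; left; apply: (map_f fst ab).
have bV : b \in V.
  by rewrite !inE mem_cat; apply/or3P/Or33/orP; right; apply: (map_f snd ab).
apply/eqP; apply/idP/idP => /existsP[q /andP[/eqP qa p0q]]; apply/existsP.
- exists (SeqSub bV); rewrite eqxx; apply: connect_trans p0q (connect1 _).
  by rewrite /adj /= [ssval q]qa ab.
- exists (SeqSub aV); rewrite eqxx; apply: connect_trans p0q (connect1 _).
  by rewrite /adj /= [ssval q]qa ab orbT.
Qed.

(** * Coloured strands and layers *)

Definition forget (C : Type) : strand (C * bool) -> strand C :=
  relabel_strand fst.

Definition flip_colour (C : Type) (x : strand (C * bool)) : strand (C * bool) :=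
  (x.1, (x.2.1, ~~ x.2.2)).

(** The signed intersection number of the part of colour [true] of the
    component [i] with the whole of it, at a crossing with upper left strand [x]
    and upper right strand [y]. The sign [-1] for parallel strands is that of
    the determinant of the directions of [x] and [y], so that which of the two
    is the overstrand has no influence. *)
Definition pairing (C : eqType) (i : C) (x y : strand (C * bool)) : int :=
  if (x.2.1 == i) && (y.2.1 == i) then
    (if x.1 == y.1 then -1 else 1) * (x.2.2%:Z - y.2.2%:Z)
  else 0.

(** With no mark, colours go straight through a tile. A mark [Some e] stands
    for the smoothing at a self-crossing of [i] of sign [e]: the incoming
    understrand has colour [true], the incoming overstrand [false], and each
    outgoing strand has the colour of the incoming strand to which the smoothing
    joins it, hence the colour opposite to that of the strand it continues. In
    terms of upper and lower ends, this is one and the same rule whether the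
    two strands are parallel or not. The number [n] is what the tile contributes
    to the wriggle number. *)
Definition tile_step (C : eqType) (i : C) (m : option int) (t : tile C)
    (s s' : seq (strand (C * bool))) (n : int) : Prop :=
  match m, t, s, s' with
  | None, Cap a, [::], [:: x; y] => [/\ forget x = a, y = opp_strand x & n = 0]
  | None, Cup, [:: x; y], [::] => y = opp_strand x /\ n = 0
  | None, Cross c, [:: x; y], [:: x'; y'] =>
      [/\ x' = y, y' = x & n = if c is Classical _ then pairing i x y else 0]
  | Some e, Cross (Classical lo), [:: x; y], [:: x'; y'] =>
      [/\ [/\ x.2.1 = i, y.2.1 = i, x.2.2 = lo (+) x.1 & y.2.2 = ~~ lo (+) y.1],
          x' = flip_colour y, y' = flip_colour x, n = 0
        & e = (if lo then -1 else 1) * (if x.1 == y.1 then 1 else -1)]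
  | _, _, _, _ => False
  end.

Definition layer_step (C : eqType) (i : C) (m : option int) (l : layer C)
    (s s' : seq (strand (C * bool))) (n : int) : Prop :=
  exists p q a b, [/\ size p = l.1, s = p ++ a ++ q, s' = p ++ b ++ q
                    & tile_step i m l.2 a b n].

Definition marked_layer (C : Type) : Type := (option int * layer C)%type.

(** A relation rather than a function of the colours above the word, since a cap
    creates strands of either colour. Words can be cut anywhere, which makes the
    weight a local quantity. *)
Fixpoint word_step (C : eqType) (i : C) (w : seq (marked_layer C))
    (s s' : seq (strand (C * bool))) (n : int) : Prop :=
  if w is (m, l) :: w' then
    exists s1 n1 n2, [/\ layer_step i m l s s1 n1, word_step i w' s1 s' n2
                       & n = n1 + n2]
  else s' = s /\ n = 0.

Definition unmarked (C : Type) (w : seq (layer C)) : seq (marked_layer C) :=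
  [seq (None, l) | l <- w].

Fixpoint mark (C : Type) (k : nat) (e : int) (w : seq (layer C)) :
    seq (marked_layer C) :=
  match w, k with
  | [::], _ => [::]
  | l :: w', 0 => (Some e, l) :: unmarked w'
  | l :: w', k'.+1 => (None, l) :: mark k' e w'
  end.

Lemma word_step_cat (C : eqType) (i : C) u v s s' n :
  word_step i (u ++ v) s s' n <->
  exists s1 n1 n2, [/\ word_step i u s s1 n1, word_step i v s1 s' n2
                     & n = n1 + n2].
Proof.
elim: u s n => [|[m l] u IH] s n /=; split.
- by move=> H; exists s, 0, n; rewrite add0r.
- by move=> [s1 [n1 [n2 [[-> ->] H ->]]]]; rewrite add0r.
- move=> [s1 [n1 [n2 [H /IH[s2 [n3 [n4 [H1 H2 ->]]]] ->]]]].
  by exists s2, (n1 + n3), n4; rewrite addrA; split=> //; exists s1, n1, n3.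
- move=> [s2 [n3 [n4 [[s1 [n1 [n2 [H1 H2 ->]]]] H ->]]]].
  exists s1, n1, (n2 + n4); rewrite addrA; split=> //; apply/IH.
  by exists s2, n2, n4.
Qed.

Lemma unmarked_cat (C : Type) (u v : seq (layer C)) :
  unmarked (u ++ v) = unmarked u ++ unmarked v.
Proof. exact: map_cat. Qed.

Lemma mark_catr (C : Type) (k : nat) e (u v : seq (layer C)) :
  mark (size u + k) e (u ++ v) = unmarked u ++ mark k e v.
Proof. by elim: u => //= l u ->. Qed.

Lemma mark_catl (C : Type) (k : nat) e (u v : seq (layer C)) :
  (k < size u)%N -> mark k e (u ++ v) = mark k e u ++ unmarked v.
Proof.
elim: u k => //= l u IH [|k] ku.
  by congr cons; exact: unmarked_cat.
by rewrite /= IH.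
Qed.

Lemma unzip2_unmarked (C : Type) (w : seq (layer C)) : unzip2 (unmarked w) = w.
Proof. by rewrite /unzip2 -map_comp map_id. Qed.

Lemma unzip2_mark (C : Type) k e (w : seq (layer C)) : unzip2 (mark k e w) = w.
Proof.
elim: w k => [|l w IH] [|k] //=; first by rewrite unzip2_unmarked.
by rewrite /= IH.
Qed.

(** * Running a word *)

Arguments layer_out : simpl never.

Lemma layer_out_cat (C : eqType) (p q : seq (strand C)) j t :
  layer_out ((size p + j)%N, t) (p ++ q) = omap (cat p) (layer_out (j, t) q).
Proof.
rewrite /layer_out size_cat -addnA leq_add2l; case: ifP => // jq.
rewrite !drop_cat take_cat !ltnNge !leq_addr /= !addKn.
by case: (tile_out _ _) => //= o; rewrite -catA.
Qed.

Lemma tile_out_size (C : eqType) (t : tile C) a b : tile_out t a = Some b ->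
  size a = ntop t /\ size b = nbot t.
Proof.
case: t => [s||c] /=; case: a => [|x [|y [|z a]]] //=.
- by case=> <-.
- by case: ifP => // _ [<-].
- by case=> <-.
Qed.

Lemma layer_outP (C : eqType) (l : layer C) s s' :
  layer_out l s = Some s' <->
  exists p a q b, [/\ size p = l.1, s = p ++ a ++ q, s' = p ++ b ++ q
                    & tile_out l.2 a = Some b].
Proof.
case: l => i t; split.
  rewrite /layer_out; case: ifP => // its.
  case E: (tile_out _ _) => [b|] //= [<-].
  exists (take i s), (take (ntop t) (drop i s)), (drop (i + ntop t) s), b.
  split=> //; first by rewrite size_takel // (leq_trans _ its) // leq_addr.
  by rewrite addnC -drop_drop !cat_take_drop.
move=> [p [a [q [b [/= <- -> ->]]]]] E; have [sa _] := tile_out_size E.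
rewrite -{1}[size p]addn0 layer_out_cat /layer_out add0n -sa size_cat leq_addr /=.
by rewrite drop0 take0 take_size_cat // E /= drop_size_cat.
Qed.

Lemma run_cons (C : eqType) (s : seq (strand C)) l w :
  run s (l :: w) = obind (@run C ^~ w) (layer_out l s).
Proof.
rewrite /run /=; case: (layer_out l s) => //=.
by elim: w => //= l' w IH; rewrite IH.
Qed.

Lemma run_cat (C : eqType) (s : seq (strand C)) u v :
  run s (u ++ v) = obind (@run C ^~ v) (run s u).
Proof.
elim: u s => //= l u IH s; rewrite !run_cons.
by case: (layer_out l s) => /=.
Qed.

Lemma forget_opp (C : Type) (x : strand (C * bool)) :
  forget (opp_strand x) = opp_strand (forget x).
Proof. by []. Qed.

Lemma tile_step_out (C : eqType) (i : C) m t a b n :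
  tile_step i m t a b n -> tile_out t (map (@forget C) a) = Some (map (@forget C) b).
Proof.
case: m t => [e|] [s||[lo|]] //=;
  case: a => [|x [|y [|z a]]] //; case: b => [|x' [|y' [|z' b]]] //=.
- by case=> _ -> ->.
- by case=> <- -> _.
- by case=> -> _; rewrite forget_opp eqxx.
- by case=> -> ->.
- by case=> -> ->.
Qed.

Lemma tile_step_size (C : eqType) (i : C) m t a b n :
  tile_step i m t a b n -> size a = ntop t /\ size b = nbot t.
Proof. by move/tile_step_out/tile_out_size; rewrite !size_map. Qed.

Lemma layer_step_out (C : eqType) (i : C) m l s s' n :
  layer_step i m l s s' n ->
  layer_out l (map (@forget C) s) = Some (map (@forget C) s').
Proof.
move=> [p [q [a [b [sp -> -> /tile_step_out E]]]]]; apply/layer_outP.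
exists (map (@forget C) p), (map (@forget C) a), (map (@forget C) q), (map (@forget C) b).
by rewrite size_map !map_cat.
Qed.

Lemma word_step_run (C : eqType) (i : C) w s s' n :
  word_step i w s s' n ->
  run (map (@forget C) s) (unzip2 w) = Some (map (@forget C) s').
Proof.
elim: w s n => [|[m l] w IH] s n /=; first by case=> ->.
by move=> [s1 [n1 [n2 [/layer_step_out E /IH H _]]]]; rewrite run_cons E.
Qed.

(** * Layers next to vertical strands *)

Lemma cat_inj (T : Type) (p p' q q' : seq T) :
  size p = size p' -> p ++ q = p' ++ q' -> p = p' /\ q = q'.
Proof. by elim: p p' => [|x p IH] [|y p'] //= [/IH H] [-> /H[-> ->]]. Qed.

Lemma cat_split (T : Type) (p p' q q' : seq T) :
  (size p <= size p')%N -> p ++ q = p' ++ q' ->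
  exists r, p' = p ++ r /\ q = r ++ q'.
Proof.
elim: p p' => [|x p IH] [|y p'] //=; try by exists p' => //; exists (y :: p').
- by move=> _ ->; exists [::].
- by move=> _ ->; exists (y :: p').
- by rewrite ltnS => /IH H [-> /H[r [-> ->]]]; exists r.
Qed.

Lemma layer_step0 (C : eqType) (i : C) m t s s' n :
  layer_step i m (0, t) s s' n <->
  exists a b q, [/\ s = a ++ q, s' = b ++ q & tile_step i m t a b n].
Proof.
split=> [[p [q [a [b [/size0nil -> -> ->]]]]] H|[a [b [q [-> -> H]]]]].
  by exists a, b, q.
by exists [::], q, a, b.
Qed.

Lemma layer_step_shift (C : eqType) (i : C) m j t p q s' n :
  layer_step i m ((size p + j)%N, t) (p ++ q) s' n <->
  exists q', s' = p ++ q' /\ layer_step i m (j, t) q q' n.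
Proof.
split.
  move=> [p1 [q1 [a [b [/= sp E -> H]]]]].
  have [|r [Ep ->]] := cat_split _ E; first by rewrite sp leq_addr.
  exists (r ++ b ++ q1); rewrite Ep -catA; split=> //; exists r, q1, a, b.
  by split=> //=; move: sp; rewrite Ep size_cat => /addnI.
move=> [q' [-> [p1 [q1 [a [b [/= <- -> -> H]]]]]]].
by exists (p ++ p1), q1, a, b; rewrite size_cat -!catA.
Qed.

Lemma layer_stepS (C : eqType) (i : C) m j t x q s' n :
  layer_step i m (j.+1, t) (x :: q) s' n <->
  exists q', s' = x :: q' /\ layer_step i m (j, t) q q' n.
Proof. exact: (layer_step_shift i m j t [:: x]). Qed.

Definition shift_marked (C : Type) (p : nat) (ml : marked_layer C) : marked_layer C :=
  (ml.1, ((p + ml.2.1)%N, ml.2.2)).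

Lemma word_step_shift (C : eqType) (i : C) p w q s' n :
  word_step i (map (shift_marked (size p)) w) (p ++ q) s' n <->
  exists q', s' = p ++ q' /\ word_step i w q q' n.
Proof.
elim: w q s' n => [|[m [j t]] w IH] q s' n.
  by split=> [[-> ->]|[q' [-> [-> ->]]]] //; exists q.
split=> /=.
  move=> [s1 [n1 [n2 [/layer_step_shift[q1 [-> H1]] H2 ->]]]].
  have /IH[q2 [-> H3]] := H2.
  by exists q2; split=> //; exists q1, n1, n2.
move=> [q2 [-> [q1 [n1 [n2 [H1 H2 ->]]]]]].
exists (p ++ q1), n1, n2; split=> //.
- by apply/layer_step_shift; exists q1.
- by apply/IH; exists q2.
Qed.

(** The form that invariance under a local move takes: both sides of the
    move allow the same boundary colours, with the same weights. *)
Definition step_equiv (C : eqType) (S : seq (strand C)) (ml mr : seq (marked_layer C)) :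
    Prop :=
  forall i s s' n, map (@forget C) s = S ->
    word_step i ml s s' n <-> word_step i mr s s' n.

Lemma step_equiv_shift (C : eqType) (S : seq (strand C)) i ml mr :
  (i <= size S)%N -> step_equiv (drop i S) ml mr ->
  step_equiv S (map (shift_marked i) ml) (map (shift_marked i) mr).
Proof.
move=> iS H j s s' n sS.
have E : size (take i s) = i by rewrite size_takel // -(size_map (@forget C)) sS.
have key w t : word_step j (map (shift_marked i) w) s t n <->
    exists q', t = take i s ++ q' /\ word_step j w (drop i s) q' n.
  by rewrite -word_step_shift E cat_take_drop.
have sS' : map (@forget C) (drop i s) = drop i S by rewrite map_drop sS.
by split=> /key [q' [-> /(H _ _ _ _ sS') H']]; apply/key; exists q'.
Qed.

(** * The intersection form *)

Lemma pairing_antisym (C : eqType) (i : C) x y : pairing i y x = - pairing i x y.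
Proof.
rewrite /pairing andbC; case: ifP; rewrite ?oppr0 // => _.
by rewrite eq_sym; case: eqP => _; ring.
Qed.

Lemma pairing_opp (C : eqType) (i : C) x y :
  pairing i x (opp_strand y) = - pairing i x y.
Proof.
rewrite /pairing /=; case: ifP; rewrite ?oppr0 // => _.
by case: x.1 y.1 => [] []; rewrite /=; ring.
Qed.

Lemma pairing_self (C : eqType) (i : C) x : pairing i x x = 0.
Proof. by rewrite /pairing; case: ifP => // _; rewrite subrr mulr0. Qed.

Definition crossing_weight (C : eqType) (i : C) c x y :=
  if c is Classical _ then pairing i x y else 0.

Lemma opp_strandK (C : Type) : involutive (@opp_strand C).
Proof. by case=> d c; rewrite /opp_strand /= negbK. Qed.

Lemma mirrorK : involutive mirror.
Proof. by case=> //= b; rewrite negbK. Qed.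

(** Turning a crossing by a quarter turn reverses one of its strands and
    exchanges over and under; both the weight and the rule at a marked crossing
    are left unchanged. This is what is behind the two slides. *)
Lemma quarter_turn (C : eqType) (i : C) m c a b a' b' n :
  tile_step i m (Cross c) [:: a; b] [:: b'; a'] n <->
  tile_step i m (Cross (mirror c)) [:: b; opp_strand a'] [:: opp_strand a; b'] n.
Proof.
have fwd c1 x1 x2 y1 y2 : tile_step i m (Cross c1) [:: x1; x2] [:: y1; y2] n ->
    tile_step i m (Cross (mirror c1)) [:: x2; opp_strand y2]
                                      [:: opp_strand x1; y1] n.
  case: m c1 => [e|] [lo|] //=.
  - case: x1 x2 => [d1 [i1 f1]] [d2 [i2 f2]] /=.
    move=> [[-> -> -> ->] -> -> -> ->]; rewrite /flip_colour /opp_strand /=.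
    by split=> //; case: lo d1 d2 => [] [] [].
  - by move=> [-> -> ->]; rewrite pairing_opp -pairing_antisym.
  - by move=> [-> -> ->].
split; first exact: fwd.
(* Four quarter turns are the identity, so that three of them invert the first. *)
by do 3!move/fwd; rewrite !mirrorK !opp_strandK.
Qed.

(** * Local moves on coloured strands *)

Arguments word_step : simpl never.

Lemma word_step1 (C : eqType) (i : C) m l s s' n :
  word_step i [:: (m, l)] s s' n <-> layer_step i m l s s' n.
Proof.
split; first by move=> [s1 [n1 [n2 [H [-> ->] ->]]]]; rewrite addr0.
by move=> H; exists s', n, 0; rewrite addr0.
Qed.

Lemma word_step_cons (C : eqType) (i : C) m l w s s' n :
  word_step i ((m, l) :: w) s s' n <->
  exists s1 n1 n2, [/\ layer_step i m l s s1 n1, word_step i w s1 s' n2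
                     & n = n1 + n2].
Proof. by []. Qed.

Lemma cross_step0 (C : eqType) (i : C) m c s s' n :
  layer_step i m (0, Cross c) s s' n <->
  exists a b a' b' q, [/\ s = [:: a, b & q], s' = [:: b', a' & q]
    & tile_step i m (Cross c) [:: a; b] [:: b'; a'] n].
Proof.
rewrite layer_step0; split; last first.
  by move=> [a [b [a' [b' [q [-> -> H]]]]]]; exists [:: a; b], [:: b'; a'], q.
move=> [a [b [q [-> -> H]]]]; have [] := tile_step_size H.
move: H; case: a => [|x [|y [|? ?]]] //; case: b => [|x' [|y' [|? ?]]] // H _ _.
by exists x, y, y', x', q.
Qed.

Lemma cap_step0 (C : eqType) (i : C) m a s s' n :
  layer_step i m (0, Cap a) s s' n <->
  exists x, [/\ m = None, forget x = a, s' = [:: x, opp_strand x & s] & n = 0].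
Proof.
rewrite layer_step0; split; last first.
  by move=> [x [-> <- -> ->]]; exists [::], [:: x; opp_strand x], s.
move=> [[|? ?] [b [q [-> -> H]]]]; last by case: m H.
by case: m H => // -; case: b => [|x [|y [|? ?]]] //= [<- -> ->]; exists x.
Qed.

Lemma cup_step0 (C : eqType) (i : C) m s s' n :
  layer_step i m (0, Cup) s s' n <->
  exists x, [/\ m = None, s = [:: x, opp_strand x & s'] & n = 0].
Proof.
rewrite layer_step0; split; last first.
  by move=> [x [-> -> ->]]; exists [:: x; opp_strand x], [::], s'.
move=> [a [b [q [-> -> H]]]]; case: m H => //.
case: a => [|x [|y [|? ?]]] //; case: b => //= -[-> ->]; by exists x.
Qed.

Lemma zigzag_left_equiv (C : eqType) (a : strand C) S :
  step_equiv (a :: S) [:: (None, (0, Cap a)); (None, (1, Cup))] [::].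
Proof.
move=> i [|x s] s' n // /(congr1 (head (forget x)))/= xa; split.
  move=> /word_step_cons[s1 [n1 [n2 [/cap_step0[y [_ ya -> ->]]]]]].
  move=> /word_step1/layer_stepS[q [-> /cup_step0[z [_ [<- -> ->] ->]] ->]].
  by rewrite opp_strandK addr0.
move=> [-> ->]; apply/word_step_cons.
exists [:: x, opp_strand x, x & s], 0, 0; split=> //.
  by apply/cap_step0; exists x.
apply/word_step1/layer_stepS; exists s; split=> //; apply/cup_step0.
by exists (opp_strand x); rewrite opp_strandK.
Qed.

Lemma zigzag_right_equiv (C : eqType) (a : strand C) S :
  step_equiv (opp_strand a :: S) [:: (None, (1, Cap a)); (None, (0, Cup))] [::].
Proof.
move=> i [|x s] s' n // /(congr1 (head (forget x)))/= xa; split.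
  move=> /word_step_cons[s1 [n1 [n2 [/layer_stepS[q [->]]]]]].
  move=> /cap_step0[y [_ ya -> ->]] /word_step1/cup_step0[z [_ [<- -> <-] ->]] ->.
  by rewrite opp_strandK addr0.
move=> [-> ->]; apply/word_step_cons.
exists [:: x, opp_strand x, x & s], 0, 0; split=> //.
  apply/layer_stepS; exists [:: opp_strand x, x & s]; split=> //.
  apply/cap_step0; exists (opp_strand x).
  split=> //; last by rewrite opp_strandK.
  by rewrite forget_opp [forget x]xa opp_strandK.
by apply/word_step1/cup_step0; exists x.
Qed.

Lemma slide_cup_equiv (C : eqType) (S : seq (strand C)) m c :
  step_equiv S [:: (m, (0, Cross c)); (None, (1, Cup))]
               [:: (m, (1, Cross (mirror c))); (None, (0, Cup))].
Proof.
move=> i s s' n _; split.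
  move=> /word_step_cons[s1 [n1 [n2 [/cross_step0[a [b [a' [b' [q [-> -> H]]]]]]]]]].
  move=> /word_step1/layer_stepS[r [-> /cup_step0[_ [_ [<- ->] ->]]]] ->.
  exists [:: a, opp_strand a, b' & r], n1, 0; split=> //.
    apply/layer_stepS; exists [:: opp_strand a, b' & r]; split=> //.
    by apply/cross_step0; exists b, (opp_strand a'), b', (opp_strand a), r;
      split=> //; apply: (proj1 (quarter_turn _ _ _ _ _ _ _ _)).
  by apply/word_step1/cup_step0; exists a.
move=> /word_step_cons[s1 [n1 [n2 [H1 /word_step1/cup_step0[a [_ E ->]] ->]]]].
move: E H1 => ->; case: s => [|a1 s].
  by case=> p [q [x [y [/= sp E]]]]; case: p sp E.
move=> /layer_stepS[q [[<- <-]]].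
move=> /cross_step0[b [c' [b' [a' [r [-> [<- ->] H]]]]]].
exists [:: b', opp_strand c', c' & r], n1, 0; split=> //.
  apply/cross_step0; exists a, b, (opp_strand c'), b', (c' :: r); split=> //.
  by apply: (proj2 (quarter_turn _ _ _ _ _ _ _ _)); rewrite opp_strandK.
apply/word_step1/layer_stepS; exists r; split=> //; apply/cup_step0.
by exists (opp_strand c'); rewrite opp_strandK.
Qed.

Lemma tile_step_forget (C : eqType) (i : C) m c a b a' b' n :
  tile_step i m (Cross c) [:: a; b] [:: b'; a'] n ->
  forget a' = forget a /\ forget b' = forget b.
Proof.
move/tile_step_out; rewrite /= /forget /relabel_strand.
by move=> [-> -> -> ->].
Qed.

Lemma slide_cap_equiv (C : eqType) (S : seq (strand C)) m a c :
  step_equiv S [:: (None, (0, Cap a)); (m, (1, Cross c))]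
               [:: (None, (1, Cap a)); (m, (0, Cross (mirror c)))].
Proof.
move=> i s s' n _; split.
  move=> /word_step_cons[s1 [n1 [n2 [/cap_step0[x [_ xa -> ->]]]]]].
  move=> /word_step1/layer_stepS[q [-> /cross_step0[_ [b [x' [b' [r [[<- ->] -> H]]]]]]]].
  move=> ->; exists [:: b, opp_strand x', x' & r], 0, n2; split=> //.
    apply/layer_stepS; exists [:: opp_strand x', x' & r]; split=> //.
    apply/cap_step0; exists (opp_strand x'); rewrite opp_strandK; split=> //.
    have [E _] := tile_step_forget H.
    by rewrite forget_opp E forget_opp opp_strandK.
  apply/word_step1/cross_step0; exists b, (opp_strand x'), b', x, (x' :: r).
  split=> //; rewrite -[x]opp_strandK.
  exact: (proj1 (quarter_turn _ _ _ _ _ _ _ _)).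
move=> /word_step_cons[s1 [n1 [n2 [H1 H2 ->]]]].
case: s H1 => [|b s].
  by case=> p [q [x [y [/= sp E]]]]; case: p sp E.
move=> /layer_stepS[q [E /cap_step0[x [_ xa Eq ->]]]].
move: H2; rewrite {}E {}Eq.
move=> /word_step1/cross_step0[? [? [b' [y [q1 [[<- <- <-] -> H]]]]]].
have {}H : tile_step i m (Cross c) [:: opp_strand y; b] [:: b'; opp_strand x] n2.
  by apply: (proj2 (quarter_turn _ _ _ _ _ _ _ _)); rewrite !opp_strandK.
have [E _] := tile_step_forget H.
exists [:: y, opp_strand y, b & s], 0, n2; split=> //.
  apply/cap_step0; exists y; split=> //.
  by rewrite -xa -[y]opp_strandK forget_opp -E forget_opp opp_strandK.
apply/word_step1/layer_stepS; exists [:: b', opp_strand x & s]; split=> //.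
by apply/cross_step0; exists (opp_strand y), b, (opp_strand x), b', s.
Qed.

(** The two strands of the kink have the same colour and opposite
    directions, so that their pairing is 0. *)
Lemma R1_cup_equiv (C : eqType) (S : seq (strand C)) c :
  step_equiv S [:: (None, (0, Cross c)); (None, (0, Cup))] [:: (None, (0, Cup))].
Proof.
move=> i s s' n _; split.
  move=> /word_step_cons[s1 [n1 [n2 [/cross_step0[a [b [a' [b' [q [-> -> H]]]]]]]]]].
  move=> /word_step1/cup_step0[x [_ [E1 E2 ->] ->]] ->.
  apply/word_step1/cup_step0; move: H; rewrite {}E1 {}E2 => -[<- <- ->].
  exists (opp_strand x); rewrite opp_strandK; split=> //.
  by case: c => [_|] //; rewrite pairing_antisym pairing_opp pairing_self !oppr0.
move=> /word_step1/cup_step0[x [_ -> ->]].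
exists [:: opp_strand x, x & s'], 0, 0; split=> //.
  apply/cross_step0; exists x, (opp_strand x), x, (opp_strand x), s'; split=> //=.
  by split=> //; case: c => //; rewrite pairing_opp pairing_self oppr0.
by apply/word_step1/cup_step0; exists (opp_strand x); rewrite opp_strandK.
Qed.

Lemma R1_cap_equiv (C : eqType) (S : seq (strand C)) a c :
  step_equiv S [:: (None, (0, Cap a)); (None, (0, Cross c))]
               [:: (None, (0, Cap (opp_strand a)))].
Proof.
move=> i s s' n _; split.
  move=> /word_step_cons[s1 [n1 [n2 [/cap_step0[x [_ xa -> ->]]]]]].
  move=> /word_step1/cross_step0[? [? [a' [b' [q [[<- <- <-] -> [-> -> ->]]]]]]] ->.
  apply/word_step1/cap_step0; exists (opp_strand x).
  rewrite forget_opp xa opp_strandK; split=> //.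
  by case: c => [_|] //; rewrite pairing_opp pairing_self oppr0.
move=> /word_step1/cap_step0[x [_ xa -> ->]].
exists [:: opp_strand x, x & s], 0, 0; split=> //.
  apply/cap_step0; exists (opp_strand x).
  by rewrite forget_opp xa !opp_strandK.
apply/word_step1/cross_step0; exists (opp_strand x), x, (opp_strand x), x, s.
split=> //; split=> //; case: c => [b0|] //=.
by rewrite pairing_antisym pairing_opp pairing_self oppr0.
Qed.

(** The weights of the two crossings cancel by antisymmetry. *)
Lemma R2_equiv (C : eqType) (a b : strand C) S c :
  step_equiv [:: a, b & S]
    [:: (None, (0, Cross c)); (None, (0, Cross (mirror c)))] [::].
Proof.
move=> i [|x [|y s]] s' n // _; split.
  move=> /word_step_cons[s1 [n1 [n2 [/cross_step0[? [? [x' [y' [q [[<- <- <-] -> [-> -> ->]]]]]]]]]]].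
  move=> /word_step1/cross_step0[? [? [x'' [y'' [r [[<- <- <-] -> [-> -> ->]]]]]]] ->.
  by split=> //; case: c => [b0|] //=; rewrite [pairing i y x]pairing_antisym subrr.
move=> [-> ->].
exists [:: y, x & s], (crossing_weight i c x y), (crossing_weight i c y x).
split; first by apply/cross_step0; exists x, y, x, y, s.
  apply/word_step1/cross_step0; exists y, x, y, x, s; split=> //.
  by split=> //; case: c.
by case: c => [b0|] //=; rewrite /= [pairing i y x]pairing_antisym subrr.
Qed.

Lemma pairing_flip_colour (C : eqType) (i : C) x y :
  pairing i (flip_colour x) (flip_colour y) = - pairing i x y.
Proof.
rewrite /pairing /=; case: ifP; rewrite ?oppr0 // => _.
by case: x.2.2 y.2.2 => [] [] /=; ring.
Qed.

(** The two crossings have opposite signs and the same index: the two strands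
    of the bigon have opposite colours in the two smoothings and come in opposite
    orders at the two crossings, so that their pairing changes sign twice. *)
Lemma R2_marked_equiv (C : eqType) (S : seq (strand C)) c e :
  step_equiv S
    [:: (Some e, (0, Cross c)); (None, (0, Cross (mirror c)))]
    [:: (None, (0, Cross c)); (Some (- e), (0, Cross (mirror c)))].
Proof.
move=> i s s' n _; split.
  move=> /word_step_cons[s1 [n1 [n2 [/cross_step0[x [y [x' [y' [q [-> -> H]]]]]]]]]].
  move=> /word_step1/cross_step0[? [? [x'' [y'' [r [[<- <- <-] -> [-> -> ->]]]]]]] ->.
  case: c H => // lo /= [[xi yi fx fy] -> -> -> ->].
  exists [:: y, x & q], (pairing i x y), 0; split=> //.
  - by apply/cross_step0; exists x, y, x, y, q.
  - apply/word_step1/cross_step0; exists y, x, (flip_colour y), (flip_colour x), q.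
    split=> //=.
    rewrite negbK; split=> //; rewrite [_ == x.1]eq_sym.
    by case: lo {fx fy}; case: eqP.
  - by rewrite pairing_flip_colour -pairing_antisym add0r addr0.
move=> /word_step_cons[s1 [n1 [n2 [/cross_step0[x [y [x' [y' [q [-> -> [-> -> ->]]]]]]]]]]].
move=> /word_step1/cross_step0[? [? [x'' [y'' [r [[<- <- <-] -> H]]]]]] ->.
case: c H => // lo /= [[xi yi fx fy] -> -> -> ee].
rewrite negbK in fy.
exists [:: flip_colour y, flip_colour x & q], 0.
exists (pairing i (flip_colour y) (flip_colour x)); split=> //.
- apply/cross_step0; exists x, y, (flip_colour x), (flip_colour y), q; split=> //=; split=> //.
  rewrite -[e]opprK ee [_ == x.1]eq_sym.
  by case: lo {fx fy ee}; case: eqP.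
- apply/word_step1/cross_step0.
  by exists (flip_colour y), (flip_colour x), (flip_colour y), (flip_colour x), q.
- by rewrite pairing_flip_colour -pairing_antisym add0r addr0.
Qed.

(** At a marked crossing the two strands are either parallel with opposite
    colours, and then changing both colours exchanges them, or antiparallel with
    the same colour, and then their pairings with [z] are opposite before and
    after the change. This is the reason for the invariance of the index of a
    crossing of a third Reidemeister move. *)
Lemma marked_pairing (C : eqType) (i : C) e c x y x' y' z n :
  tile_step i (Some e) (Cross c) [:: x; y] [:: y'; x'] n ->
  pairing i z x' + pairing i z y' = pairing i z x + pairing i z y.
Proof.
case: c => // lo; case: x y z => [dx [cx fx]] [dy [cy fy]] [dz [cz fz]] /=.
move=> [[-> -> -> ->] -> -> _ _]; rewrite /pairing /= eqxx andbT.
by case: (cz == i) => //; case: dx dy dz lo fz => [] [] [] [] [].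
Qed.

(** In the two lemmas below, [x], [y], [z] are the coloured strands at the top, from
    left to right, and the indices count the crossings that each has gone
    through; the numbering of [m1], [c1], [n1] and so on follows the pairs of
    strands 12, 13, 23 on both sides of the move. *)
Lemma R3_top (C : eqType) (i : C) m1 m2 m3 c1 c2 c3 s s' n :
  word_step i [:: (m1, (0, Cross c1)); (m2, (1, Cross c2)); (m3, (0, Cross c3))]
    s s' n <->
  exists x y z x1 y1 z1 x2 y2 z2 q n1 n2 n3,
  [/\ s = [:: x, y, z & q] /\ s' = [:: z2, y2, x2 & q],
      tile_step i m1 (Cross c1) [:: x; y] [:: y1; x1] n1,
      tile_step i m2 (Cross c2) [:: x1; z] [:: z1; x2] n2,
      tile_step i m3 (Cross c3) [:: y1; z1] [:: z2; y2] n3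
    & n = n1 + n2 + n3].
Proof.
split.
  move=> /word_step_cons[s1 [n1 [n0 [/cross_step0[x [y [x1 [y1 [q [-> -> H1]]]]]] W ->]]]].
  move: W => /word_step_cons[s2 [n2 [n3 [/layer_stepS[r [->]]]]]].
  move=> /cross_step0[? [z [x2 [z1 [q2 [[<- ->] -> H2]]]]]].
  move=> /word_step1/cross_step0[? [? [y2 [z2 [? [[<- <- <-] -> H3]]]]]] ->.
  by exists x, y, z, x1, y1, z1, x2, y2, z2, q2, n1, n2, n3; rewrite addrA.
move=> [x [y [z [x1 [y1 [z1 [x2 [y2 [z2 [q [n1 [n2 [n3 [[-> ->] H1 H2 H3 ->]]]]]]]]]]]]]].
exists [:: y1, x1, z & q], n1, (n2 + n3); rewrite addrA; split=> //.
  by apply/cross_step0; exists x, y, x1, y1, (z :: q).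
exists [:: y1, z1, x2 & q], n2, n3; split=> //.
  apply/layer_stepS; exists [:: z1, x2 & q]; split=> //.
  by apply/cross_step0; exists x1, z, x2, z1, q.
by apply/word_step1/cross_step0; exists y1, z1, y2, z2, (x2 :: q).
Qed.

Lemma R3_bottom (C : eqType) (i : C) m1 m2 m3 c1 c2 c3 s s' n :
  word_step i [:: (m3, (1, Cross c3)); (m2, (0, Cross c2)); (m1, (1, Cross c1))]
    s s' n <->
  exists x y z x1 y1 z1 x2 y2 z2 q n1 n2 n3,
  [/\ s = [:: x, y, z & q] /\ s' = [:: z2, y2, x2 & q],
      tile_step i m3 (Cross c3) [:: y; z] [:: z1; y1] n3,
      tile_step i m2 (Cross c2) [:: x; z1] [:: z2; x1] n2,
      tile_step i m1 (Cross c1) [:: x1; y1] [:: y2; x2] n1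
    & n = n1 + n2 + n3].
Proof.
split.
  case: s => [|x s] /word_step_cons[s1 [n3 [n0 []]]].
    by case=> p [q [a [b [/= sp E]]]]; case: p sp E.
  move=> /layer_stepS[r [-> /cross_step0[y [z [y1 [z1 [q [-> -> H3]]]]]]]] W ->.
  move: W => /word_step_cons[s2 [n2 [n1 []]]].
  move=> /cross_step0[? [? [x1 [z2 [? [[<- <- <-] -> H2]]]]]].
  move=> /word_step1/layer_stepS[? [->]].
  move=> /cross_step0[? [? [x2 [y2 [? [[<- <- <-] -> H1]]]]]] ->.
  exists x, y, z, x1, y1, z1, x2, y2, z2, q, n1, n2, n3; split=> //.
  by rewrite addrC [n2 + n1]addrC.
move=> [x [y [z [x1 [y1 [z1 [x2 [y2 [z2 [q [n1 [n2 [n3 [[-> ->] H3 H2 H1 ->]]]]]]]]]]]]]].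
exists [:: x, z1, y1 & q], n3, (n2 + n1); split; last 1 first.
- by rewrite addrC [n1 + n2]addrC.
- apply/layer_stepS; exists [:: z1, y1 & q]; split=> //.
  by apply/cross_step0; exists y, z, y1, z1, q.
exists [:: z2, x1, y1 & q], n2, n1; split=> //.
  by apply/cross_step0; exists x, z1, x1, z2, (y1 :: q).
apply/word_step1/layer_stepS; exists [:: y2, x2 & q]; split=> //.
by apply/cross_step0; exists x1, y1, x2, y2, q.
Qed.

Lemma R3_equiv (C : eqType) (S : seq (strand C)) c1 c2 c3 :
  step_equiv S
    [:: (None, (0, Cross c1)); (None, (1, Cross c2)); (None, (0, Cross c3))]
    [:: (None, (1, Cross c3)); (None, (0, Cross c2)); (None, (1, Cross c1))].
Proof.
move=> i s s' n _; rewrite R3_top R3_bottom; split.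
  move=> [x [y [z [? [? [? [? [? [? [q [n1 [n2 [n3 [[-> ->]]]]]]]]]]]]]]].
  move=> [-> -> H1] [-> -> H2] [-> -> H3] ->.
  by exists x, y, z, x, y, z, x, y, z, q, n1, n2, n3.
move=> [x [y [z [? [? [? [? [? [? [q [n1 [n2 [n3 [[-> ->]]]]]]]]]]]]]]].
move=> [-> -> H1] [-> -> H2] [-> -> H3] ->.
by exists x, y, z, x, y, z, x, y, z, q, n1, n2, n3.
Qed.

Lemma marked_classical (C : eqType) (i : C) e c a b n :
  tile_step i (Some e) (Cross c) a b n -> exists lo, c = Classical lo.
Proof. by case: c => // lo; exists lo. Qed.

Lemma marked_out (C : eqType) (i : C) e c x y x' y' n :
  tile_step i (Some e) (Cross c) [:: x; y] [:: y'; x'] n ->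
  [/\ x' = flip_colour x, y' = flip_colour y & n = 0].
Proof. by case: c => // lo [_ -> -> ->]. Qed.

(** The admissibility condition matters only through the following consequence:
    next to a classical crossing, the other two are both classical or both
    virtual, so that [marked_pairing] applies to their sum of weights. *)
Lemma R3_marked1 (C : eqType) (S : seq (strand C)) e c1 c2 c3 :
  R3_admissible c1 c2 c3 ->
  step_equiv S
    [:: (Some e, (0, Cross c1)); (None, (1, Cross c2)); (None, (0, Cross c3))]
    [:: (None, (1, Cross c3)); (None, (0, Cross c2)); (Some e, (1, Cross c1))].
Proof.
move=> adm i s s' n _; rewrite R3_top R3_bottom.
have key x y x' y' z k : tile_step i (Some e) (Cross c1) [:: x; y] [:: y'; x'] k ->
    crossing_weight i c2 x' z + crossing_weight i c3 y' z =
    crossing_weight i c2 x z + crossing_weight i c3 y z.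
  move=> H; have [lo Ec1] := marked_classical H.
  move: adm; rewrite Ec1; case: c2 c3 => [?|] [?|] //= _.
  by rewrite ![pairing i _ z]pairing_antisym -!opprD (marked_pairing z H).
split.
  move=> [x [y [z [x1 [y1 [? [? [? [? [q [n1 [n2 [n3 [[-> ->]]]]]]]]]]]]]]].
  move=> H [-> -> H2] [-> -> H3] ->.
  exists x, y, z, x, y, z, x1, y1, z, q, n1.
  exists (crossing_weight i c2 x z), (crossing_weight i c3 y z); split=> //.
  by rewrite -addrA H2 H3 [X in _ + X](key _ _ _ _ z _ H) addrA.
move=> [x [y [z [? [? [? [x1 [y1 [? [q [n1 [n2 [n3 [[-> ->]]]]]]]]]]]]]]].
move=> [-> -> H3] [-> -> H2] H ->.
exists x, y, z, x1, y1, z, x1, y1, z, q, n1.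
exists (crossing_weight i c2 x1 z), (crossing_weight i c3 y1 z); split=> //.
by rewrite -addrA H2 H3 -addrA; congr (_ + _); rewrite (key _ _ _ _ z _ H).
Qed.

Lemma R3_marked2 (C : eqType) (S : seq (strand C)) e c1 c2 c3 :
  R3_admissible c1 c2 c3 ->
  step_equiv S
    [:: (None, (0, Cross c1)); (Some e, (1, Cross c2)); (None, (0, Cross c3))]
    [:: (None, (1, Cross c3)); (Some e, (0, Cross c2)); (None, (1, Cross c1))].
Proof.
move=> adm i s s' n _; rewrite R3_top R3_bottom.
have key x z x' z' y k : tile_step i (Some e) (Cross c2) [:: x; z] [:: z'; x'] k ->
    crossing_weight i c1 x' y + crossing_weight i c3 y z =
    crossing_weight i c1 x y + crossing_weight i c3 y z'.
  move=> H; have [lo Ec2] := marked_classical H.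
  move: adm; rewrite Ec2; case: c1 c3 => [?|] [?|] //= _.
  rewrite ![pairing i _ y]pairing_antisym; have := marked_pairing y H.
  lia.
split.
  move=> [x [y [z [? [? [z1 [x1 [? [? [q [n1 [n2 [n3 [[-> ->]]]]]]]]]]]]]]].
  move=> [-> -> H1] H [-> -> H3] ->.
  exists x, y, z, x1, y, z, x1, y, z1, q.
  exists (crossing_weight i c1 x1 y), n2, (crossing_weight i c3 y z); split=> //.
  by rewrite addrAC H1 H3 -(key _ _ _ _ y _ H) addrAC.
move=> [x [y [z [x1 [? [? [? [? [z1 [q [n1 [n2 [n3 [[-> ->]]]]]]]]]]]]]]].
move=> [-> -> H3] H [-> -> H1] ->.
exists x, y, z, x, y, z1, x1, y, z1, q.
exists (crossing_weight i c1 x y), n2, (crossing_weight i c3 y z1); split=> //.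
by rewrite addrAC H1 H3 [X in X + _](key _ _ _ _ y _ H) addrAC.
Qed.

Lemma R3_marked3 (C : eqType) (S : seq (strand C)) e c1 c2 c3 :
  R3_admissible c1 c2 c3 ->
  step_equiv S
    [:: (None, (0, Cross c1)); (None, (1, Cross c2)); (Some e, (0, Cross c3))]
    [:: (Some e, (1, Cross c3)); (None, (0, Cross c2)); (None, (1, Cross c1))].
Proof.
move=> adm i s s' n _; rewrite R3_top R3_bottom.
have key y z y' z' x k : tile_step i (Some e) (Cross c3) [:: y; z] [:: z'; y'] k ->
    crossing_weight i c1 x y' + crossing_weight i c2 x z' =
    crossing_weight i c1 x y + crossing_weight i c2 x z.
  move=> H; have [lo Ec3] := marked_classical H.
  move: adm; rewrite Ec3; case: c1 c2 => [?|] [?|] //= _.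
  by rewrite (marked_pairing x H).
split.
  move=> [x [y [z [? [? [? [? [y1 [z1 [q [n1 [n2 [n3 [[-> ->]]]]]]]]]]]]]]].
  move=> [-> -> H1] [-> -> H2] H ->.
  exists x, y, z, x, y1, z1, x, y1, z1, q.
  exists (crossing_weight i c1 x y1), (crossing_weight i c2 x z1), n3; split=> //.
  by rewrite H1 H2 [in RHS](key _ _ _ _ x _ H).
move=> [x [y [z [? [y1 [z1 [? [? [? [q [n1 [n2 [n3 [[-> ->]]]]]]]]]]]]]]].
move=> H [-> -> H2] [-> -> H1] ->.
exists x, y, z, x, y, z, x, y1, z1, q.
exists (crossing_weight i c1 x y), (crossing_weight i c2 x z), n3; split=> //.
by rewrite H1 H2 [X in X + _](key _ _ _ _ x _ H).
Qed.

Lemma exchange_equiv (C : eqType) (S : seq (strand C)) i j a b m1 m2 :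
  (i + nbot a <= j)%N ->
  step_equiv S [:: (m1, (i, a)); (m2, (j, b))]
               [:: (m2, ((j - nbot a + ntop a)%N, b)); (m1, (i, a))].
Proof.
move=> ij c s s' n _; split.
  move=> /word_step_cons[s1 [n1 [n2 [[p [q [x [x' [/= sp -> -> H1]]]]]]]]].
  move=> /word_step1[p2 [q2 [y [y' [/= sp2 E -> H2]]]]] ->.
  have [sx sx'] := tile_step_size H1.
  move: E; rewrite catA => E; have [|r [Ep Eq]] := cat_split _ E.
    by rewrite size_cat sp sp2 sx'.
  exists ((p ++ x ++ r) ++ y' ++ q2), n2, n1; split; last by rewrite addrC.
    exists (p ++ x ++ r), q2, y, y'; split=> //=.
      rewrite -sp2 Ep !size_cat sx sx' sp; lia.
    by rewrite Eq -!catA.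
  apply/word_step1; exists p, (r ++ y' ++ q2), x, x'.
  by rewrite Ep -!catA.
move=> /word_step_cons[s1 [n1 [n2 [[p [q [y [y' [/= sp -> -> H1]]]]]]]]].
move=> /word_step1[p2 [q2 [x [x' [/= sp2 E -> H2]]]]] ->.
have [sx sx'] := tile_step_size H2.
move: (esym E); rewrite catA => E'; have [|r [Ep Eq]] := cat_split _ E'.
  by rewrite size_cat sp sp2 sx; lia.
exists (p2 ++ x' ++ r ++ y ++ q), n2, n1; split; last by rewrite addrC.
  exists p2, (r ++ y ++ q), x, x'; split=> //; by rewrite Ep -!catA.
apply/word_step1; exists (p2 ++ x' ++ r), q, y, y'; split=> //=.
- by rewrite !size_cat sp2 sx'; move: sp; rewrite Ep !size_cat sp2 sx; lia.
- by rewrite -!catA.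
- by rewrite Eq -!catA.
Qed.

(** * Colourings of points and of strands *)

Fixpoint colour_at (C : Type) (g : nat -> bool) (s : seq (strand C)) :
    seq (strand (C * bool)) :=
  if s is a :: s' then (a.1, (a.2, g 0)) :: colour_at (g \o succn) s' else [::].

Lemma size_colour_at (C : Type) g (s : seq (strand C)) : size (colour_at g s) = size s.
Proof. by elim: s g => //= a s IH g; rewrite IH. Qed.

Lemma forget_colour_at (C : Type) g (s : seq (strand C)) :
  map (@forget C) (colour_at g s) = s.
Proof. by elim: s g => //= -[d c] s IH g; rewrite IH. Qed.

Lemma eq_colour_at (C : Type) g h (s : seq (strand C)) :
  (forall j, (j < size s)%N -> g j = h j) <-> colour_at g s = colour_at h s.
Proof.
elim: s g h => //= a s IH g h; split.
  by move=> gh; rewrite gh //; congr cons; apply/IH => j /= js; apply: gh.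
by move=> [g0 /IH gh] [|j] // js; apply: gh.
Qed.

Lemma colour_at_cat (C : Type) g (s t : seq (strand C)) :
  colour_at g (s ++ t) = colour_at g s ++ colour_at (fun j => g (size s + j)%N) t.
Proof.
elim: s g => [|a s IH] g /=; first by apply/eq_colour_at.
by rewrite IH; congr (_ :: _ ++ _); apply/eq_colour_at.
Qed.

Lemma colour_atP (C : Type) (s : seq (strand (C * bool))) :
  exists g, s = colour_at g (map (@forget C) s).
Proof.
elim: s => [|[d [c f]] s [g IH]]; first by exists (fun=> false).
by exists (fun j => if j is j'.+1 then g j' else f); rewrite /= {1}IH.
Qed.

Definition layer_crossing (C : Type) (k : nat) (l : layer C)
    (s : seq (strand C)) : option (crossing C) :=
  if l is (i, Cross (Classical left_over)) then
    if drop i s is a :: b :: _ then Some (mk_crossing k i left_over a b) else None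
  else None.

(** For [F] the indicator function of component one, the contribution of [c] to
    the wriggle number: as component two is the rest of the component [i], the
    difference of the two linking numbers is linear in [F]. *)
Definition crossing_jump (C : eqType) (i : C) (F : point -> bool) (c : crossing C) : int :=
  if (over_component c == i) && (under_component c == i) then
    sgn c * ((F (over_in c))%:Z - (F (under_in c))%:Z)
  else 0.

Lemma respects_cat (T : Type) (F : T -> bool) E1 E2 :
  respects F (E1 ++ E2) = respects F E1 && respects F E2.
Proof. exact: all_cat. Qed.

Lemma respects_through (C : Type) k (t : tile C) (F : point -> bool)
    (p a q : seq (strand C)) :
  size a = ntop t ->
  respects F (through_arcs k (size (p ++ a ++ q)) (size p, t)) <->
  colour_at (fun j => F (k, j)) p = colour_at (fun j => F (k.+1, j)) p /\
  colour_at (fun j => F (k, size p + (size a + j))%N) q =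
  colour_at (fun j => F (k.+1, size p + (nbot t + j))%N) q.
Proof.
move=> sa; rewrite /through_arcs respects_cat /respects !all_map.
rewrite -!eq_colour_at !size_cat addnA -sa addKn; split.
  move=> /andP[/allP Hp /allP Hq]; split=> j jp.
    by apply/eqP/(Hp j); rewrite mem_iota.
  have /= := Hq (size p + size a + j)%N.
  rewrite mem_iota leq_addr ltn_add2l jp => /(_ isT)/eqP.
  rewrite -!addnA => ->; congr (F (_, _)); lia.
move=> [Hp Hq]; apply/andP; split; apply/allP => j; rewrite mem_iota /=.
  by move=> jp; rewrite Hp.
move=> /andP[jl jr]; have := Hq (j - (size p + size a))%N.
rewrite addnA subnKC // => ->; last lia.
apply/eqP; congr (F (_, _)); lia.
Qed.

Lemma layer_step_positions (C : eqType) (i : C) m (t : tile C) (g h : nat -> bool)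
    (p a b q : seq (strand C)) n :
  size a = ntop t -> size b = nbot t ->
  layer_step i m (size p, t) (colour_at g (p ++ a ++ q)) (colour_at h (p ++ b ++ q)) n <->
  [/\ colour_at g p = colour_at h p,
      colour_at (fun j => g (size p + (size a + j))%N) q =
      colour_at (fun j => h (size p + (nbot t + j))%N) q
    & tile_step i m t (colour_at (fun j => g (size p + j)%N) a)
                      (colour_at (fun j => h (size p + j)%N) b) n].
Proof.
move=> sa sb; rewrite !colour_at_cat; split; last first.
  rewrite -sb => -[Ep Eq H].
  exists (colour_at g p), (colour_at (fun j => g (size p + (size a + j))%N) q).
  exists (colour_at (fun j => g (size p + j)%N) a), (colour_at (fun j => h (size p + j)%N) b).
  by rewrite size_colour_at; split=> //; rewrite Ep Eq sb.
move=> [p1 [q1 [a1 [b1 [/= sp E E' H]]]]].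
have [sa1 sb1] := tile_step_size H.
have [|Ep E1] := cat_inj _ E; first by rewrite size_colour_at sp.
have [|Ep' E2] := cat_inj _ E'; first by rewrite size_colour_at sp.
have [|Ea Eq] := cat_inj _ E1; first by rewrite size_colour_at sa1.
have [|Eb Eq'] := cat_inj _ E2; first by rewrite size_colour_at sb1.
by rewrite Ep Ep' -sb Eq Eq' Ea Eb.
Qed.

Lemma crossing_jump_mk_crossing (C : eqType) (i : C) (F : point -> bool) k i0 lo
    (x y : strand C) :
  F (k, i0) = F (k.+1, i0.+1) -> F (k, i0.+1) = F (k.+1, i0) ->
  crossing_jump i F (mk_crossing k i0 lo x y) =
  pairing i (x.1, (x.2, F (k, i0))) (y.1, (y.2, F (k, i0.+1))).
Proof.
case: x y => [dx cx] [dy cy] E1 E2; rewrite /crossing_jump /pairing /mk_crossing /=.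
case: lo; last rewrite [(cx == i) && _]andbC.
  by case: dx; case: dy; rewrite /= ?E1 ?E2; case: ifP => // _; ring.
by case: dx; case: dy; rewrite /= ?E1 ?E2; case: ifP => // _; ring.
Qed.

(** Colours that go straight through a layer are functions constant along
    its arcs, and the weight does not depend on the description of a crossing by
    its corners or by its over and under strands. *)
Lemma unmarked_layer_stepP (C : eqType) (i : C) k l (S S' : seq (strand C)) F n :
  layer_out l S = Some S' ->
  layer_step i None l (colour_at (fun j => F (k, j)) S)
                      (colour_at (fun j => F (k.+1, j)) S') n <->
  respects F (through_arcs k (size S) l ++ tile_arcs k l) /\
  n = oapp (crossing_jump i F) 0 (layer_crossing k l S).
Proof.
case: l => i0 t /layer_outP[p [a [q [b [/= <- -> -> tab]]]]].
have [sa sb] := tile_out_size tab.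
suff key : tile_step i None t (colour_at (fun j => F (k, size p + j)%N) a)
     (colour_at (fun j => F (k.+1, size p + j)%N) b) n <->
   respects F (tile_arcs k (size p, t)) /\
   n = oapp (crossing_jump i F) 0 (layer_crossing k (size p, t) (p ++ a ++ q)).
  rewrite respects_cat; split.
    move=> /layer_step_positions[] // Ep Eq /key[-> ->]; split=> //.
    by rewrite andbT; apply/respects_through.
  move=> [/andP[/respects_through[//|Ep Eq] H] E].
  by apply/layer_step_positions => //; split=> //; apply/key.
rewrite /layer_crossing drop_size_cat //.
case: t tab {sa sb} => [s||c].
- case: a => // -[<-] /=; rewrite addn0 addn1 /forget /relabel_strand /=.
  rewrite /respects /= andbT /opp_strand /=; case: s => d j /=.
  split; first by move=> [_ [->] ->]; rewrite eqxx.
  by move=> [/eqP -> ->].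
- case: a => [|x [|y [|? ?]]] //=; case: eqP => // -> [<-] /=.
  rewrite addn0 addn1 /respects /= andbT /opp_strand /=.
  split; first by move=> [[->] ->]; rewrite eqxx.
  by move=> [/eqP -> ->].
- case: a => [|x [|y [|? ?]]] // -[<-] /=.
  rewrite addn0 addn1 /respects /= andbT; split.
    move=> [[E1] [E2] ->]; rewrite E1 E2 !eqxx; split=> //; case: c => //= lo.
    by rewrite crossing_jump_mk_crossing ?E1 ?E2.
  move=> [/andP[/eqP E1 /eqP E2] ->]; rewrite E1 E2; split=> //.
  by case: c => //= lo; rewrite crossing_jump_mk_crossing ?E1 ?E2.
Qed.

Lemma mk_crossing_data (C : Type) k i lo (x y : strand C) :
  let c := mk_crossing k i lo x y in
  [/\ height c = k,
      over_component c = (if lo then x.2 else y.2),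
      under_component c = (if lo then y.2 else x.2)
    & sgn c = (if lo then -1 else 1) * (if x.1 == y.1 then 1 else -1)].
Proof. by case: lo. Qed.

Lemma marked_layer_stepP (C : eqType) (i : C) e k l (S S' : seq (strand C)) F n :
  layer_out l S = Some S' ->
  layer_step i (Some e) l (colour_at (fun j => F (k, j)) S)
                          (colour_at (fun j => F (k.+1, j)) S') n <->
  exists c, [/\ layer_crossing k l S = Some c,
    [/\ over_component c = i, under_component c = i, sgn c = e & n = 0],
    respects F (through_arcs k (size S) l ++
                [:: (under_in c, over_out c); (over_in c, under_out c)]),
    F (under_in c) = true & F (over_in c) = false].
Proof.
case: l => i0 t /layer_outP[p [a [q [b [/= <- -> -> tab]]]]].
have [sa sb] := tile_out_size tab.
suff key : tile_step i (Some e) t (colour_at (fun j => F (k, size p + j)%N) a)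
     (colour_at (fun j => F (k.+1, size p + j)%N) b) n <->
    exists c, [/\ layer_crossing k (size p, t) (p ++ a ++ q) = Some c,
      [/\ over_component c = i, under_component c = i, sgn c = e & n = 0],
      respects F [:: (under_in c, over_out c); (over_in c, under_out c)],
      F (under_in c) = true & F (over_in c) = false].
  split.
    move=> /layer_step_positions[] // Ep Eq /key[c [H1 H2 H3 H4 H5]].
    exists c; split=> //; rewrite respects_cat H3 andbT.
    exact/respects_through.
  move=> [c [H1 H2 + H4 H5]]; rewrite respects_cat.
  move=> /andP[/respects_through[//|Ep Eq] H3].
  by apply/layer_step_positions => //; split=> //; apply/key; exists c.
rewrite /layer_crossing drop_size_cat //.
case: t tab {sa sb} => [s||c].
- by case: a => // -[<-] /=; split=> // -[c []].
- by case: a => [|x [|y [|? ?]]] //=; case: eqP => // _ _ /=; split=> // -[c []].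
case: a => [|x [|y [|? ?]]] // -[<-] /=.
case: c => [lo|]; last by split=> // -[c []].
rewrite addn0 addn1 /flip_colour /respects /=.
set d := mk_crossing k (size p) lo x y.
have [_ Eo Eu Es] := mk_crossing_data k (size p) lo x y.
split.
  move=> [[xi yi fx fy] [Fy] [Fx] -> ->]; exists d; rewrite Eo Eu Es.
  move: fx fy Fy Fx; rewrite xi yi !if_same /d /mk_crossing => fx fy Fy Fx.
  split=> //; case: lo fx fy {d Eo Eu Es} => fx fy; rewrite /= ?andbT;
  case: (x.1) (y.1) fx fy => [] [] /= fx fy; rewrite ?Fx ?Fy ?fx ?fy //.
move=> [_ [[<-]]]; rewrite Eo Eu Es => -[oi ui <- ->].
have [xi yi] : x.2 = i /\ y.2 = i by case: (lo) oi ui => -> ->.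
rewrite xi yi /d /mk_crossing; case: lo {d Eo Eu Es oi ui};
 case: x xi => x1 x2 /= _; case: y yi => y1 y2 /= _; case: x1; case: y1 => /=;
 rewrite ?andbT => /andP[/eqP H1 /eqP H2] H3 H4; move: H1 H2; rewrite ?H3 ?H4.
all: by move=> E1 E2; split; rewrite ?H3 ?H4 -?E1 -?E2 ?H3 ?H4.
Qed.

(** * Smoothings as coloured runs of a diagram *)

Arguments run : simpl never.

Lemma strands_atS (C : eqType) (D : diagram C) k l :
  run (dtop D) (dword D) <> None -> onth (dword D) k = Some l ->
  layer_out l (strands_at D k) = Some (strands_at D k.+1).
Proof.
rewrite /strands_at; move: (dtop D) (dword D) => S w.
elim: w S k => [|l0 w IH] S [|k] //; rewrite run_cons /=.
  by rewrite take0 run_cons => + [<-]; case: (layer_out l0 S).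
by rewrite !run_cons; case: (layer_out l0 S) => //= S1 H /IH->.
Qed.

Lemma onth_mark (C : Type) k0 e (w : seq (layer C)) k :
  onth (mark k0 e w) k = omap (pair (if k == k0 then Some e else None)) (onth w k).
Proof.
elim: w k0 k => [|l w IH] [|k0] [|k] //=; last by rewrite IH.
by rewrite onth_map.
Qed.

Lemma size_mark (C : Type) k e (w : seq (layer C)) : size (mark k e w) = size w.
Proof. by rewrite -{2}(unzip2_mark k e w) size_map. Qed.

Lemma onth_size (T : Type) (s : seq T) k : (k < size s)%N <-> exists x, onth s k = Some x.
Proof. by rewrite -onthTE; case: (onth s k) => [x|]; split=> //; [exists x|case]. Qed.

Lemma respects_arcs (C : eqType) (D : diagram C) c F :
  respects F (arcs D c) <->
  forall k l, onth (dword D) k = Some l ->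
    respects F (through_arcs k (size (strands_at D k)) l ++
      (if c is Some c0 then
         if height c0 == k
         then [:: (under_in c0, over_out c0); (over_in c0, under_out c0)]
         else tile_arcs k l
       else tile_arcs k l)).
Proof.
rewrite /arcs; set G := fun kl : nat * layer C => _ ++ _.
have key a w : respects F (flatten [seq G kl | kl <- zip (iota a (size w)) w]) <->
    forall k l, onth w k = Some l -> respects F (G ((a + k)%N, l)).
  elim: w a => [|l0 w IH] a; first by split=> // _ [].
  rewrite /= respects_cat; split.
    move=> /andP[H /IH H'] [|k] l /=; first by move=> [<-]; rewrite addn0.
    by move=> /H'; rewrite addnS.
  move=> H; rewrite -{1}[a]addn0 H //=; apply/IH => k l kl.
  by rewrite addSnnS H.
exact: key.
Qed.

(** Colourings of the smoothing of [D] at the crossing in layer [k]. The sign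
    [e] of the crossing and its component [i] are recorded, so that these data
    determine the contribution of the crossing to the polynomial. *)
Definition smoothing_colouring (C : eqType) (D : diagram C) (k : nat) (i : C)
    (e n : int) : Prop :=
  exists s s', map (@forget C) s = dtop D /\
               word_step i (mark k e (dword D)) s s' n.

Lemma word_step_positions (C : eqType) (i : C) w (s s' : seq (strand (C * bool))) n :
  word_step i w s s' n ->
  exists (F : point -> bool) (ns : nat -> int),
  let lev k := odflt [::] (run (map (@forget C) s) (take k (unzip2 w))) in
  [/\ s = colour_at (fun j => F (0, j)) (map (@forget C) s),
      forall k m l, onth w k = Some (m, l) ->
        layer_step i m l (colour_at (fun j => F (k, j)) (lev k))
                         (colour_at (fun j => F (k.+1, j)) (lev k.+1)) (ns k)
    & n = \sum_(k < size w) ns k].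
Proof.
elim: w s n => [|[m l] w IH] s n.
  have [g sg] := colour_atP s.
  move=> [_ ->]; exists (fun p => g p.2), (fun=> 0).
  by rewrite big_ord0; split=> // -[].
move=> /word_step_cons[s1 [n1 [n2 [H /IH[F [ns [Es1 HF ->]]] ->]]]].
have [g Es] := colour_atP s.
exists (fun p => if p.1 is k.+1 then F (k, p.2) else g p.2).
exists (fun k => if k is k'.+1 then ns k' else n1).
split=> //; last by rewrite big_ord_recl.
move=> [|k] m' l' /=.
  move=> [<- <-]; rewrite take0 run_cons (layer_step_out H) /= -Es.
  rewrite -Es1; exact: H.
move=> /HF; by rewrite !run_cons (layer_step_out H).
Qed.

Lemma positions_word_step (C : eqType) (i : C) w (S : seq (strand C)) F (ns : nat -> int) :
  let lev k := odflt [::] (run S (take k (unzip2 w))) in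
  (forall k m l, onth w k = Some (m, l) ->
     layer_step i m l (colour_at (fun j => F (k, j)) (lev k))
                      (colour_at (fun j => F (k.+1, j)) (lev k.+1)) (ns k)) ->
  word_step i w (colour_at (fun j => F (0, j)) S)
    (colour_at (fun j => F (size w, j)) (lev (size w))) (\sum_(k < size w) ns k).
Proof.
elim: w S F ns => [|[m l] w IH] S F ns /= H; first by rewrite big_ord0.
have H0 := H 0 _ _ erefl; rewrite /= take0 run_cons in H0.
have [S1 El] : exists S1, layer_out l S = Some S1.
  by have := layer_step_out H0; rewrite !forget_colour_at => E; eexists; exact: E.
rewrite run_cons El /= in H0 *.
exists (colour_at (fun j => F (1, j)) S1), (ns 0).
exists (\sum_(k < size w) ns k.+1); split=> //; last by rewrite big_ord_recl.
apply: (IH _ (fun p => F (p.1.+1, p.2)) (fun k => ns k.+1)).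
by move=> k m' l' /(H k.+1)/=; rewrite !run_cons El.
Qed.

Lemma crossing_in_layerE (C : eqType) (D : diagram C) k :
  crossing_in_layer D k =
  obind (fun l => layer_crossing k l (strands_at D k)) (onth (dword D) k).
Proof. by rewrite /crossing_in_layer; case: (onth _ _) => [[j [s||[lo|]]]|]. Qed.

Lemma crossing_in_layerP (C : eqType) (D : diagram C) k c :
  crossing_in_layer D k = Some c <->
  exists i lo a b q p, [/\ onth (dword D) k = Some (i, Cross (Classical lo)),
    size p = i, strands_at D k = p ++ [:: a, b & q] & c = mk_crossing k i lo a b].
Proof.
rewrite crossing_in_layerE; split.
  case: (onth _ _) => [[i [s||[lo|]]]|] //=.
  case E: (drop i _) => [|a [|b q]] // [<-].
  exists i, lo, a, b, q, (take i (strands_at D k)); split=> //.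
    apply: size_takel; have : (0 < size (drop i (strands_at D k)))%N by rewrite E.
    by rewrite size_drop subn_gt0 => /ltnW.
  by rewrite -E cat_take_drop.
move=> [i [lo [a [b [q [p [-> <- E ->]]]]]]] /=.
by rewrite E drop_size_cat.
Qed.

Lemma crossing_in_layer_height (C : eqType) (D : diagram C) k c :
  crossing_in_layer D k = Some c -> height c = k.
Proof.
move=> /crossing_in_layerP[i [lo [a [b [q [p [_ _ _ ->]]]]]]].
by case: (mk_crossing_data k i lo a b).
Qed.

Lemma smoothing_colouringP (C : eqType) (D : diagram C) k i e n :
  run (dtop D) (dword D) <> None -> (k < size (dword D))%N ->
  smoothing_colouring D k i e n <-> exists c F,
    [/\ crossing_in_layer D k = Some c,
        [/\ over_component c = i, under_component c = i & sgn c = e],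
        respects F (arcs D (Some c)),
        F (under_in c) = true /\ F (over_in c) = false
      & n = \sum_(k' < size (dword D) | val k' != k)
              oapp (crossing_jump i F) 0 (crossing_in_layer D k')].
Proof.
move=> valid kD; split.
  move=> [s [s' [Es /word_step_positions[F [ns []]]]]] _.
  rewrite Es unzip2_mark size_mark => HF En.
  have {HF} HF k' l : onth (dword D) k' = Some l ->
      layer_step i (if k' == k then Some e else None) l
        (colour_at (fun j => F (k', j)) (strands_at D k'))
        (colour_at (fun j => F (k'.+1, j)) (strands_at D k'.+1)) (ns k').
    by move=> kl; apply: HF; rewrite onth_mark kl.
  have /onth_size[l kl] := kD.
  have := HF k l kl; rewrite eqxx => /(marked_layer_stepP _ _ _ _ _ (strands_atS valid kl)).
  move=> [c [H1 [Eo Eu Es' En0] H3 H4 H5]].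
  have cD : crossing_in_layer D k = Some c by rewrite crossing_in_layerE kl.
  exists c, F; split=> //.
    apply/respects_arcs => k' l' kl'; rewrite (crossing_in_layer_height cD).
    rewrite eq_sym; case: eqP => [Ek|/eqP Ek].
      by move: kl'; rewrite Ek kl => -[<-].
    have := HF k' l' kl'; rewrite (negPf Ek).
    by move=> /(unmarked_layer_stepP _ _ _ _ (strands_atS valid kl'))[].
  rewrite En (bigD1 (Ordinal kD)) //= En0 add0r; apply: eq_big => // k'.
  rewrite -val_eqE /= => Ek.
  have /onth_size[l' kl'] := ltn_ord k'.
  have := HF k' l' kl'; rewrite (negPf Ek).
  move=> /(unmarked_layer_stepP _ _ _ _ (strands_atS valid kl'))[_ ->].
  by rewrite crossing_in_layerE kl'.
move=> [c [F [cD [oi ui se] Hr [HF1 HF0] En]]].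
pose ns k' := if k' == k then 0 else oapp (crossing_jump i F) 0 (crossing_in_layer D k').
exists (colour_at (fun j => F (0, j)) (dtop D)).
have -> : n = \sum_(k' < size (mark k e (dword D))) ns k'.
  rewrite size_mark (bigD1 (Ordinal kD)) //= {1}/ns eqxx add0r En.
  by apply: eq_big => // k' Ek; rewrite /ns (negPf Ek).
eexists; split; first exact: forget_colour_at.
apply: positions_word_step => k' m l; rewrite onth_mark unzip2_mark.
case kl: (onth _ _) => [l'|] //= [<- <-] {m l}.
have sS := strands_atS valid kl.
move/respects_arcs: Hr => /(_ k' l' kl); rewrite (crossing_in_layer_height cD).
rewrite eq_sym /ns; case: eqP => [Ek|Ek] Hr.
  apply/(marked_layer_stepP _ _ _ _ _ sS); exists c; split=> //.
  by move: cD; rewrite crossing_in_layerE -Ek kl.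
apply/(unmarked_layer_stepP _ _ _ _ sS); split=> //.
by rewrite crossing_in_layerE kl.
Qed.

Definition colour_by (C : Type) (g : C -> bool) : strand C -> strand (C * bool) :=
  relabel_strand (fun c => (c, g c)).

Lemma forget_colour_by (C : Type) (g : C -> bool) s :
  map (@forget C) (map (colour_by g) s) = s.
Proof. by elim: s => //= -[d c] s ->. Qed.

(** If the colour of a strand depends only on its component, then two strands
    of [i] have the same colour and all weights vanish. *)
Lemma layer_step_components (C : eqType) (i : C) g l S S' :
  layer_out l S = Some S' ->
  layer_step i None l (map (colour_by g) S) (map (colour_by g) S') 0.
Proof.
case: l => i0 t /layer_outP[p [a [q [b [/= sp -> -> tab]]]]].
exists (map (colour_by g) p), (map (colour_by g) q).
exists (map (colour_by g) a), (map (colour_by g) b).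
rewrite size_map !map_cat; split=> //=.
case: t tab => [s||c]; case: a => [|x [|y [|? ?]]] //=.
- by move=> [<-] /=; split=> //; case: s.
- by case: eqP => // -> [<-].
move=> [<-] /=; split=> //; case: c => // _; rewrite /pairing /=.
by case: ifP => // /andP[/eqP-> /eqP->]; rewrite subrr mulr0.
Qed.

Lemma word_step_components (C : eqType) (i : C) g w S S' :
  run S w = Some S' ->
  word_step i (unmarked w) (map (colour_by g) S) (map (colour_by g) S') 0.
Proof.
elim: w S => [|l w IH] S; first by move=> [->].
rewrite run_cons; case E: (layer_out l S) => [S1|] //= /IH H.
by exists (map (colour_by g) S1), 0, 0; split=> //; apply: layer_step_components.
Qed.

(** * The index of a self-crossing *)

Lemma joined_respects (T : choiceType) (E : seq (T * T)) x :
  respects (joined E x) E.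
Proof.
apply/allP => e eE; apply/eqP.
have He f : respects f E -> f e.1 = f e.2 by move=> /allP/(_ e eE)/eqP.
apply/idP/idP => /joinedP H; apply/joinedP => f fE.
- by rewrite H // He.
- by rewrite H // He.
Qed.

Lemma joined_refl (T : choiceType) (E : seq (T * T)) x : joined E x x.
Proof. exact/joinedP. Qed.

Lemma joined_eq (T : choiceType) (E : seq (T * T)) x y z :
  joined E x y -> joined E x z = joined E y z.
Proof.
move=> /joinedP xy; apply/idP/idP => /joinedP H; apply/joinedP => f fE.
- by rewrite -H // xy.
- by rewrite xy // H.
Qed.

Lemma component_at_points (C : eqType) (D : diagram C) p i :
  (p.1 <= size (dword D))%N -> component_at D p = Some i -> p \in points D.
Proof.
case: p => k j /= kD; rewrite /component_at /= => H.
apply/allpairsPdep; exists k, j; split=> //; first by rewrite mem_iota.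
rewrite mem_iota /= add0n -(size_map snd); apply/onth_size.
by exists i.
Qed.

Lemma component_at_mid (C : eqType) (D : diagram C) k p x q :
  strands_at D k = p ++ x :: q -> component_at D (k, size p) = Some x.2.
Proof.
move=> E; rewrite /component_at /= E /unzip2 map_cat onth_cat size_map.
by rewrite ltnn subnn.
Qed.

Lemma crossing_corners (C : eqType) (D : diagram C) k i lo a b q p :
  run (dtop D) (dword D) <> None ->
  onth (dword D) k = Some (i, Cross (Classical lo)) ->
  size p = i -> strands_at D k = p ++ [:: a, b & q] ->
  [/\ component_at D (k, i) = Some a.2, component_at D (k, i.+1) = Some b.2,
      component_at D (k.+1, i) = Some b.2 & component_at D (k.+1, i.+1) = Some a.2].
Proof.
move=> valid kl sp E; have := strands_atS valid kl; rewrite E -sp.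
rewrite -{1}[size p]addn0 layer_out_cat /layer_out /= take0 !drop0 /= => -[E'].
have E2 : strands_at D k = rcons p a ++ b :: q by rewrite E cat_rcons.
have E2' : strands_at D k.+1 = rcons p b ++ a :: q by rewrite -E' cat_rcons.
by split; [apply: component_at_mid E | | apply: component_at_mid (esym E') |];
  rewrite -?(size_rcons p a) ?(component_at_mid E2) //
          (size_rcons p a) -(size_rcons p b) (component_at_mid E2').
Qed.

Lemma crossing_components (C : eqType) (D : diagram C) k c :
  run (dtop D) (dword D) <> None -> crossing_in_layer D k = Some c ->
  [/\ component_at D (over_in c) = Some (over_component c),
      component_at D (over_out c) = Some (over_component c),
      component_at D (under_in c) = Some (under_component c)
    & component_at D (under_out c) = Some (under_component c)].
Proof.
move=> valid /crossing_in_layerP[i [lo [a [b [q [p [kl sp E ->]]]]]]].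
have [H1 H2 H3 H4] := crossing_corners valid kl sp E.
by rewrite /mk_crossing; case: lo {kl} => /=; case: a.1; case: b.1.
Qed.

Lemma crossing_points (C : eqType) (D : diagram C) k c :
  run (dtop D) (dword D) <> None -> crossing_in_layer D k = Some c ->
  over_in c \in points D /\ under_in c \in points D.
Proof.
move=> valid kc; have [H1 _ H2 _] := crossing_components valid kc.
move: kc H1 H2 => /crossing_in_layerP[i [lo [a [b [q [p [kl sp E ->]]]]]]].
have kD : (k < size (dword D))%N by apply/onth_size; eexists; exact: kl.
move=> /component_at_points H1 /component_at_points H2.
split; [apply: H1|apply: H2].
- by rewrite /mk_crossing; case: lo {kl H2}; case: a.1; case: b.1 => //=; apply: ltnW.
- by rewrite /mk_crossing; case: lo {kl H1}; case: a.1; case: b.1 => //=; apply: ltnW.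
Qed.

Lemma crossing_ends (C : eqType) (D : diagram C) k c l (g : point -> bool) :
  crossing_in_layer D k = Some c -> onth (dword D) k = Some l ->
  [/\ g (over_in c), g (over_out c), g (under_in c) & g (under_out c)] ->
  respects g (tile_arcs k l).
Proof.
move=> /crossing_in_layerP[i [lo [a [b [q [p [-> _ _ ->]]]]]]] [<-].
rewrite /mk_crossing /respects /=; case: lo; case: a.1; case: b.1 => /=.
all: by move=> [-> -> -> ->].
Qed.

Lemma respects_component (C : eqType) (D : diagram C) (i : C) :
  run (dtop D) (dword D) <> None ->
  respects (fun p => component_at D p == Some i) (arcs D None).
Proof.
move=> valid; apply/respects_arcs => k l kl.
have sS := strands_atS valid kl.
have E k' : colour_at (fun j => component_at D (k', j) == Some i) (strands_at D k') =
    map (colour_by (fun c => c == i)) (strands_at D k').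
  rewrite /component_at /=; elim: (strands_at D k') => //= a s <-.
  by congr (_ :: _).
have := layer_step_components i (fun c => c == i) sS; rewrite -!E.
move=> H; have [] // := proj1 (unmarked_layer_stepP i k
  (fun p => component_at D p == Some i) 0 sS) H.
Qed.

(** A function with value [true] at the four ends of the crossing cannot
    tell the arcs of the crossing from those of its smoothing. *)
Lemma respects_smoothing (C : eqType) (D : diagram C) c k (g : point -> bool) :
  run (dtop D) (dword D) <> None -> crossing_in_layer D k = Some c ->
  [/\ g (over_in c), g (over_out c), g (under_in c) & g (under_out c)] ->
  respects g (arcs D None) <-> respects g (arcs D (Some c)).
Proof.
move=> valid kc ends; have hc := crossing_in_layer_height kc.
split=> /respects_arcs H; apply/respects_arcs => k' l kl; have := H k' l kl.
  rewrite !respects_cat hc; case: eqP => // Ek /andP[-> _] /=.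
  by rewrite /respects /=; case: ends => -> -> -> ->.
rewrite !respects_cat hc; case: eqP => // Ek /andP[-> _] /=.
by rewrite -Ek in kl *; apply: crossing_ends kc kl ends.
Qed.

(** The points joined to one of the two incoming strands in the smoothing
    include the four ends of the crossing, hence form a union of components of
    the unsmoothed diagram. *)
Lemma split_component (C : finType) (D : diagram C) k c p :
  is_tangle_diagram D -> crossing_in_layer D k = Some c ->
  over_component c = under_component c ->
  p \in points D -> component_at D p = Some (under_component c) ->
  joined (arcs D (Some c)) (under_in c) p || joined (arcs D (Some c)) (over_in c) p.
Proof.
move=> [valid _ conn] kc ou pD pi.
have valid' : run (dtop D) (dword D) <> None by rewrite valid.
have [_ uD] := crossing_points valid' kc.
have [_ _ ui _] := crossing_components valid' kc.
have /joinedP H := conn _ _ uD pD (etrans ui (esym pi)).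
pose g z := joined (arcs D (Some c)) (under_in c) z ||
            joined (arcs D (Some c)) (over_in c) z.
have gr : respects g (arcs D (Some c)).
  apply/allP => e eE; rewrite /g.
  by rewrite (eqP (allP (joined_respects _ _) e eE))
             (eqP (allP (joined_respects _ (over_in c)) e eE)).
have sm : joined (arcs D (Some c)) (under_in c) (over_out c) /\
          joined (arcs D (Some c)) (over_in c) (under_out c).
  have [kl] : exists l, onth (dword D) k = Some l.
    by move: kc; rewrite crossing_in_layerE; case: (onth _ _) => // l; exists l.
  move=> kl'; have H1 f : respects f (arcs D (Some c)) ->
      f (under_in c) = f (over_out c) /\ f (over_in c) = f (under_out c).
    move=> /respects_arcs/(_ _ _ kl').
    rewrite respects_cat (crossing_in_layer_height kc) eqxx /respects /=.
    by move=> /and4P[_ /eqP -> /eqP ->].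
  by split; apply/joinedP => f /H1[].
have gr0 : respects g (arcs D None).
  apply: (proj2 (respects_smoothing valid' kc _)); last exact: gr.
  by rewrite /g !joined_refl (proj1 sm) (proj2 sm) !orbT.
by have := H g gr0; rewrite /g joined_refl => <-.
Qed.

(** On the component [i], any colouring of the smoothing agrees with the
    indicator function of component one, by [split_component]. *)
Lemma smoothing_wriggleE (C : finType) (D : diagram C) k c i F :
  is_tangle_diagram D -> crossing_in_layer D k = Some c ->
  over_component c = i -> under_component c = i ->
  respects F (arcs D (Some c)) -> F (under_in c) = true -> F (over_in c) = false ->
  smoothing_wriggle D c =
    \sum_(k' < size (dword D) | val k' != k)
       oapp (crossing_jump i F) 0 (crossing_in_layer D k').
Proof.
move=> tD kc oi ui Fr Fu Fo.
have valid : run (dtop D) (dword D) <> None by case: tD => ->.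
set L1 := joined (arcs D (Some c)) (under_in c).
set L2 := joined (arcs D (Some c)) (over_in c).
(* Inside [i], component one is where [F] is true, and component two the rest. *)
have inside p : p \in points D -> component_at D p = Some i ->
    L1 p = F p /\ L2 p = ~~ F p.
  move=> pD pi; rewrite -ui in pi.
  have := split_component tD kc (etrans oi (esym ui)) pD pi.
  rewrite -/L1 -/L2; case L1p: (L1 p); case L2p: (L2 p) => //.
  - by move/joinedP: L1p => /(_ F Fr); move/joinedP: L2p => /(_ F Fr); rewrite Fu Fo => <-.
  - by move/joinedP: L1p => /(_ F Fr); rewrite Fu => <-.
  - by move/joinedP: L2p => /(_ F Fr); rewrite Fo => <-.
(* Components one and two do not leave [i], as the smoothing only joins strands of [i]. *)
have outside p : component_at D p != Some i -> L1 p = false /\ L2 p = false.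
  move=> pi; have [oc oc' uc uc'] := crossing_components valid kc.
  have h : respects (fun p => component_at D p == Some i) (arcs D (Some c)).
    apply: (proj1 (respects_smoothing valid kc _)); last exact: respects_component.
    by rewrite oc oc' uc uc' oi ui eqxx.
  split; apply: contraNF pi => /joinedP/(_ _ h) <-.
    by rewrite uc ui.
  by rewrite oc oi.
rewrite /smoothing_wriggle /wriggle /vlk -/L1 -/L2 !big_filter_cond.
rewrite !big_mkcondr -sumrB /= /crossings big_mkcond big_pmap.
have -> : iota 0 (size (dword D)) = index_iota 0 (size (dword D)).
  by rewrite /index_iota subn0.
rewrite big_mkord [RHS]big_mkcond; apply: eq_bigr => k' _.
case kd: (crossing_in_layer D k') => [d|] /=; last by case: ifP.
rewrite (crossing_in_layer_height kd) (crossing_in_layer_height kc).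
case: ifP => // _; have [oc _ uc _] := crossing_components valid kd.
have [oD uD] := crossing_points valid kd.
rewrite /crossing_jump; case: (over_component d =P i) => [o|o]; last first.
  have [] := outside (over_in d); first by rewrite oc; apply/eqP => -[].
  by move=> -> ->; rewrite /= ?andbF subrr.
case: (under_component d =P i) => [u|u]; last first.
  have [] := outside (under_in d); first by rewrite uc; apply/eqP => -[].
  by move=> -> ->; rewrite /= ?andbF subrr.
rewrite o in oc; rewrite u in uc.
have [-> ->] := inside _ oD oc; have [-> ->] := inside _ uD uc.
by case: (F _); case: (F _); rewrite /=; ring.
Qed.

Definition crossing_term (C : eqType) (F : fieldType) (D : diagram C) (x : C -> F) k : F :=
  oapp (fun c => if over_component c == under_component c
                 then (sgn c)%:~R * (x (under_component c) ^ smoothing_wriggle D c - 1)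
                 else 0) 0 (crossing_in_layer D k).

Lemma Wsc_crossing_terms (C : finType) (F : fieldType) (D : diagram C) (x : C -> F) :
  Wsc D x = \sum_(k < size (dword D)) crossing_term D x k.
Proof.
rewrite /Wsc (eq_bigr (fun i => \sum_(c <- crossings D)
   if (over_component c == i) && (under_component c == i)
   then (sgn c)%:~R * (x i ^ smoothing_wriggle D c - 1) else 0)); last first.
  by move=> i _; rewrite big_mkcond.
rewrite exchange_big /= /crossings big_pmap.
have -> : iota 0 (size (dword D)) = index_iota 0 (size (dword D)).
  by rewrite /index_iota subn0.
rewrite big_mkord; apply: eq_bigr => k _; rewrite /crossing_term.
case: (crossing_in_layer D k) => //= c.
rewrite (bigD1 (under_component c)) //= eqxx andbT big1 ?addr0 // => i ic.
by rewrite [under_component c == i]eq_sym (negPf ic) andbF.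
Qed.

Lemma crossing_term_colouring (C : finType) (F : fieldType) (D : diagram C)
    (x : C -> F) k i e n :
  is_tangle_diagram D -> (k < size (dword D))%N -> smoothing_colouring D k i e n ->
  crossing_term D x k = e%:~R * (x i ^ n - 1).
Proof.
move=> tD kD; have valid : run (dtop D) (dword D) <> None by case: tD => ->.
move=> /(smoothing_colouringP _ _ _ valid kD)[c [G [kc [oi ui se] Gr [Gu Go] ->]]].
rewrite /crossing_term kc /= oi ui eqxx se.
by rewrite (smoothing_wriggleE tD kc oi ui Gr Gu Go).
Qed.

(** When the two incoming strands are joined in the smoothing, components one
    and two are the same set and the wriggle number is 0; otherwise the indicator
    function of component one is a colouring. *)
Lemma colouring_of_crossing_term (C : finType) (F : fieldType) (D : diagram C) (x : C -> F) k :
  is_tangle_diagram D -> (k < size (dword D))%N -> crossing_term D x k != 0 ->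
  exists i e n, smoothing_colouring D k i e n.
Proof.
move=> tD kD; have valid : run (dtop D) (dword D) <> None by case: tD => ->.
rewrite /crossing_term; case kc: (crossing_in_layer D k) => [c|] /=; last by rewrite eqxx.
case: (over_component c =P _) => [ou|_]; last by rewrite eqxx.
case uo: (joined (arcs D (Some c)) (under_in c) (over_in c)).
  suff -> : smoothing_wriggle D c = 0 by rewrite expr0z subrr mulr0 eqxx.
  rewrite /smoothing_wriggle /wriggle /vlk; apply/eqP; rewrite subr_eq0; apply/eqP.
  by apply: eq_bigl => d; rewrite !(joined_eq _ uo).
move=> _; exists (under_component c), (sgn c); eexists.
apply/smoothing_colouringP => //; exists c, (joined (arcs D (Some c)) (under_in c)).
split=> //; first exact: joined_respects.
by rewrite joined_refl uo.
Qed.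

(** Since any colouring determines the term of its crossing, and a term
    without colourings vanishes, it is enough to carry colourings from one
    diagram to the other; the weight has to be followed in one direction only. *)
Lemma crossing_term_transfer (C C' : finType) (F : fieldType) (D : diagram C)
    (E : diagram C') (h : C -> C') (y : C' -> F) k k' (sg : int) :
  is_tangle_diagram D -> is_tangle_diagram E ->
  (k < size (dword D))%N -> (k' < size (dword E))%N ->
  (forall i e n, smoothing_colouring D k i e n ->
     smoothing_colouring E k' (h i) (sg * e) n) ->
  (forall i e n, smoothing_colouring E k' i e n ->
     exists i' e' n', smoothing_colouring D k i' e' n') ->
  crossing_term E y k' = sg%:~R * crossing_term D (y \o h) k.
Proof.
move=> tD tE kD kE DE ED.
case: (crossing_term D (y \o h) k =P 0) =>
  [D0|/eqP/(colouring_of_crossing_term tD kD)[i [e [n H]]]].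
  rewrite D0 mulr0; have [//|E0] := eqVneq (crossing_term E y k') 0.
  have [i [e [n /ED[i' [e' [n' H]]]]]] := colouring_of_crossing_term tE kE E0.
  rewrite (crossing_term_colouring y tE kE (DE _ _ _ H)) rmorphM -mulrA.
  by rewrite -[_ * (_ - 1)](crossing_term_colouring (y \o h) tD kD H) D0 mulr0.
rewrite (crossing_term_colouring y tE kE (DE _ _ _ H)) rmorphM -mulrA.
by rewrite (crossing_term_colouring (y \o h) tD kD H).
Qed.

(** * Invariance of the self-crossing wriggle polynomial *)

Lemma word_step_context (C : eqType) (i : C) S mu ml mr mv s s' n :
  run (map (@forget C) s) (unzip2 mu) = Some S -> step_equiv S ml mr ->
  word_step i (mu ++ ml ++ mv) s s' n -> word_step i (mu ++ mr ++ mv) s s' n.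
Proof.
move=> E H /word_step_cat[s1 [n1 [n0 [W1 /word_step_cat[s2 [n2 [n3 [W2 W3 ->]]]] ->]]]].
have E1 : map (@forget C) s1 = S by have := word_step_run W1; rewrite E => -[].
apply/word_step_cat; exists s1, n1, (n2 + n3); split=> //.
by apply/word_step_cat; exists s2, n2, n3; split=> //; apply/(H _ _ _ _ E1).
Qed.

Lemma step_equiv_sym (C : eqType) (S : seq (strand C)) ml mr :
  step_equiv S ml mr -> step_equiv S mr ml.
Proof. by move=> H i s s' n E; split=> /(H i s s' n E). Qed.

(** Colours are carried across the piece of word where the two diagrams differ,
    with the same colours on the rest. The factor [sg] is 1, or -1 if the
    corresponding crossings have opposite signs. *)
Lemma crossing_term_context (C : finType) (F : fieldType) (D E : diagram C) (x : C -> F)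
    S k k' (sg : int) (mu ml mr mv : int -> seq (marked_layer C)) :
  is_tangle_diagram D -> is_tangle_diagram E ->
  (k < size (dword D))%N -> (k' < size (dword E))%N -> dtop D = dtop E ->
  sg * sg = 1 ->
  (forall e, [/\ mark k e (dword D) = mu e ++ ml e ++ mv e,
     mark k' (sg * e) (dword E) = mu e ++ mr e ++ mv e,
     run (dtop D) (unzip2 (mu e)) = Some S & step_equiv S (ml e) (mr e)]) ->
  crossing_term E x k' = sg%:~R * crossing_term D x k.
Proof.
move=> tD tE kD kE DE sg1 H; apply: (crossing_term_transfer (h := id)) => //.
  move=> i e n [s [s' [Es W]]]; have [E1 E2 E3 E4] := H e.
  exists s, s'; rewrite -DE; split=> //; rewrite E2.
  by apply: word_step_context E4 _; rewrite ?Es // -E1.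
move=> i e n [s [s' [Es W]]]; have [E1 E2 E3 E4] := H (sg * e).
exists i, (sg * e), n, s, s'; rewrite DE; split=> //; rewrite E1.
rewrite mulrA sg1 mul1r in E2.
by apply: (word_step_context _ (step_equiv_sym E4)); rewrite ?Es -?DE // -E2.
Qed.

Lemma crossing_term_local (C : finType) (F : fieldType) (D E : diagram C) (x : C -> F)
    S u l r v j j' (sg : int) :
  is_tangle_diagram D -> is_tangle_diagram E -> dtop D = dtop E ->
  dword D = u ++ l ++ v -> dword E = u ++ r ++ v ->
  run (dtop D) u = Some S -> (j < size l)%N -> (j' < size r)%N -> sg * sg = 1 ->
  (forall e, step_equiv S (mark j e l) (mark j' (sg * e) r)) ->
  crossing_term E x (size u + j') = sg%:~R * crossing_term D x (size u + j).
Proof.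
move=> tD tE DE wD wE uS jl jr sg1 H.
apply: (@crossing_term_context C F D E x S _ _ sg (fun=> unmarked u) (fun e => mark j e l)
  (fun e => mark j' (sg * e) r) (fun=> unmarked v)) => //.
- by rewrite wD !size_cat ltn_add2l ltn_addr.
- by rewrite wE !size_cat ltn_add2l ltn_addr.
by move=> e; rewrite wD wE !mark_catr !mark_catl // unzip2_unmarked.
Qed.

Lemma crossing_term_extremum (C : finType) (F : fieldType) (D : diagram C) (x : C -> F)
    u l v j i t :
  dword D = u ++ l ++ v -> onth l j = Some (i, t) ->
  (if t is Cross _ then false else true) ->
  crossing_term D x (size u + j) = 0.
Proof.
move=> wD lj tE; rewrite /crossing_term crossing_in_layerE wD.
have jl : (j < size l)%N by apply/onth_size; eexists; exact: lj.
rewrite !onth_cat ltnNge leq_addr /= addKn jl lj /=.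
by case: t tE {lj}.
Qed.

(** For the crossing of a kink: one of the two pieces of the smoothing is a small
    loop without other crossings, so there is a colouring which depends only on
    the component outside of the loop, and its weight is 0. *)
Definition isolates (C : eqType) (S : seq (strand C)) j (l : seq (layer C)) :=
  forall i e s s' n, map (@forget C) s = S -> word_step i (mark j e l) s s' n ->
  exists g S', word_step i (mark j e l) (map (colour_by g) S) (map (colour_by g) S') 0.

(** Extending the colours by components above and below the kink gives a
    colouring of weight 0. *)
Lemma crossing_term_isolated (C : finType) (F : fieldType) (D : diagram C) (x : C -> F)
    S u l v j :
  is_tangle_diagram D -> dword D = u ++ l ++ v -> (j < size l)%N ->
  run (dtop D) u = Some S -> isolates S j l ->
  crossing_term D x (size u + j) = 0.
Proof.
move=> tD wD jl uS H.
have kD : (size u + j < size (dword D))%N.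
  by rewrite wD !size_cat ltn_add2l ltn_addr.
have [//|/(colouring_of_crossing_term tD kD)[i [e [n [s [s' [Es]]]]]]] :=
  eqVneq (crossing_term D x (size u + j)) 0.
rewrite wD mark_catr mark_catl // => /word_step_cat[s1 [n1 [n0 [W1]]]].
move=> /word_step_cat[s2 [n2 [n3 [W2 W3 _]]]] _.
have E1 : map (@forget C) s1 = S.
  by have := word_step_run W1; rewrite unzip2_unmarked Es uS => -[].
have [g [S' W]] := H _ _ _ _ _ E1 W2.
have [vS] : exists B, run S' v = Some B.
  case: (tD) => + _ _; rewrite wD run_cat uS /= run_cat.
  have := word_step_run W; rewrite unzip2_mark !forget_colour_by => -> /= ->.
  by eexists.
move=> vB; rewrite (crossing_term_colouring x tD kD (i := i) (e := e) (n := 0)).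
  by rewrite expr0z subrr mulr0.
exists (map (colour_by g) (dtop D)), (map (colour_by g) vS); rewrite forget_colour_by.
split=> //; rewrite wD mark_catr mark_catl //; apply/word_step_cat.
exists (map (colour_by g) S), 0, 0; split=> //; first exact: word_step_components.
apply/word_step_cat; exists (map (colour_by g) S'), 0, 0; split=> //.
exact: word_step_components.
Qed.

Definition shift_layers (C : Type) (i : nat) (l : seq (layer C)) : seq (layer C) :=
  [seq ((i + x.1)%N, x.2) | x <- l].

Lemma mark_shift (C : Type) i j e (l : seq (layer C)) :
  mark j e (shift_layers i l) = map (shift_marked i) (mark j e l).
Proof.
elim: l j => [|y l IH] [|j] //=; last by rewrite IH.
by rewrite /unmarked -!map_comp.
Qed.

Lemma unmarked_shift (C : Type) i (l : seq (layer C)) :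
  unmarked (shift_layers i l) = map (shift_marked i) (unmarked l).
Proof. by rewrite /unmarked -!map_comp. Qed.

Lemma isolates_shift (C : eqType) (S : seq (strand C)) i j (l : seq (layer C)) :
  (i <= size S)%N -> isolates (drop i S) j l ->
  isolates S j (shift_layers i l).
Proof.
move=> iS H c e s s' n Es; rewrite mark_shift.
have Ei : i = size (take i s) by rewrite size_takel // -(size_map (@forget C)) Es.
rewrite -{1}(cat_take_drop i s) {1}Ei => /word_step_shift[q' [_ W]].
have [|g [S' W']] := H _ _ _ _ _ _ W; first by rewrite map_drop Es.
exists g, (take i S ++ S'); rewrite -{1}(cat_take_drop i S) !map_cat.
have {1}-> : i = size (map (colour_by g) (take i S)) by rewrite size_map size_takel.
by apply/word_step_shift; eexists; split; first by [].
Qed.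

Lemma R1_cup_isolates (C : eqType) (S : seq (strand C)) c :
  isolates S 0 [:: (0, Cross c); (0, Cup)].
Proof.
move=> i e s s' n <- /word_step_cons[s1 [n1 [n2 []]]].
move=> /cross_step0[a [b [a' [b' [q [-> -> H]]]]]].
move=> /word_step1/cup_step0[y [_ [E1 E2 E3] ->]] _.
have [Ea Eb n10] := marked_out H.
have Ec : a.2.2 = b.2.2.
  by have := E2; rewrite Ea -E1 Eb => /(congr1 (fun y => y.2.2))/negb_inj.
exists (fun=> a.2.2), (map (@forget C) q); rewrite n10 in H.
exists [:: b', a' & map (colour_by (fun=> a.2.2)) (map (@forget C) q)], 0, 0.
split=> //.
  apply/cross_step0; exists a, b, a', b'; eexists; split; [|reflexivity|exact: H].
  by rewrite /= {2}Ec; case: (a) => ? []; case: (b) => ? [].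
apply/word_step1/cup_step0; exists b'; split=> //.
by congr [:: _, _ & _]; rewrite E2 E1.
Qed.

Lemma R1_cap_isolates (C : eqType) (S : seq (strand C)) a c :
  isolates S 1 [:: (0, Cap a); (0, Cross c)].
Proof.
move=> i e s s' n <- /word_step_cons[s1 [n1 [n2 []]]].
move=> /cap_step0[y [_ ya -> _]] /word_step1/cross_step0[? [? [a' [b' [q]]]]].
move=> [[<- <- <-] _ H] _; have [Ea Eb n20] := marked_out H; rewrite n20 in H.
(* Outside of the kink, all strands have the colour opposite to that of the loop. *)
exists (fun=> ~~ y.2.2), (forget b' :: forget a' :: map (@forget C) s).
exists ([:: y, opp_strand y & map (colour_by (fun=> ~~ y.2.2)) (map (@forget C) s)]), 0, 0.
split=> //; first by apply/cap_step0; exists y.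
apply/word_step1/cross_step0; exists y, (opp_strand y), a', b'; eexists.
split; [reflexivity| |exact: H].
by rewrite Ea Eb.
Qed.

Lemma layer_out_size (C : eqType) (S : seq (strand C)) i t w B :
  run S ((i, t) :: w) = Some B -> (i + ntop t <= size S)%N.
Proof. by rewrite run_cons /layer_out; case: ifP. Qed.

Lemma run_shift (C : eqType) (S : seq (strand C)) i w B :
  (i <= size S)%N -> run S (shift_layers i w) = Some B ->
  exists B', run (drop i S) w = Some B'.
Proof.
move=> iS.
have H p q C' : run (p ++ q) (shift_layers (size p) w) = Some C' ->
    exists B', run q w = Some B'.
  elim: w q => [|[j t] w IH] q; first by eexists.
  by rewrite /= !run_cons layer_out_cat; case: (layer_out _ q) => //= q' /IH.
move=> E; apply: (H (take i S) _ B).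
by rewrite cat_take_drop size_takel.
Qed.

Lemma shift_layers0 (C : Type) i (t : tile C) : shift_layers i [:: (0, t)] = [:: (i, t)].
Proof. by rewrite /shift_layers /= addn0. Qed.

Lemma shift_layers00 (C : Type) i (t t' : tile C) :
  shift_layers i [:: (0, t); (0, t')] = [:: (i, t); (i, t')].
Proof. by rewrite /shift_layers /= addn0. Qed.

Lemma shift_layers01 (C : Type) i (t t' : tile C) :
  shift_layers i [:: (0, t); (1, t')] = [:: (i, t); (i.+1, t')].
Proof. by rewrite /shift_layers /= addn0 addn1. Qed.

Lemma shift_layers10 (C : Type) i (t t' : tile C) :
  shift_layers i [:: (1, t); (0, t')] = [:: (i.+1, t); (i, t')].
Proof. by rewrite /shift_layers /= addn0 addn1. Qed.

Lemma shift_layers010 (C : Type) i (t t' t'' : tile C) :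
  shift_layers i [:: (0, t); (1, t'); (0, t'')] = [:: (i, t); (i.+1, t'); (i, t'')].
Proof. by rewrite /shift_layers /= addn0 addn1. Qed.

Lemma shift_layers101 (C : Type) i (t t' t'' : tile C) :
  shift_layers i [:: (1, t); (0, t'); (1, t'')] = [:: (i.+1, t); (i, t'); (i.+1, t'')].
Proof. by rewrite /shift_layers /= addn0 addn1. Qed.

Lemma zigzag_left_run (C : eqType) (S : seq (strand C)) s B :
  run S [:: (0, Cap s); (1, Cup)] = Some B -> exists S', S = s :: S'.
Proof.
rewrite run_cons /layer_out /= !drop0 !take0 /= run_cons /layer_out /=.
case: S => [|y S] //=; rewrite take0 /=; case: eqP => // -> _.
by rewrite opp_strandK; exists S.
Qed.

Lemma zigzag_right_run (C : eqType) (S : seq (strand C)) s B :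
  run S [:: (1, Cap s); (0, Cup)] = Some B -> exists S', S = opp_strand s :: S'.
Proof.
case: S => [|y S] //; rewrite run_cons /layer_out /= !drop0 !take0 /=.
rewrite run_cons /layer_out /=; case: eqP => // -> _.
by rewrite opp_strandK; exists S.
Qed.

Lemma R2_run (C : eqType) (S : seq (strand C)) c d w B :
  run S ((0, Cross c) :: (0, Cross d) :: w) = Some B ->
  exists a b S', S = [:: a, b & S'].
Proof.
rewrite run_cons /layer_out.
by case: S => [|a [|b S']] //= _; exists a, b, S'.
Qed.

Arguments unmarked : simpl never.

(** The crossings of the two sides of a move correspond to each other and
    have the same term, except for the crossing of a kink, whose term is 0, and
    those of a bigon, whose terms are opposite. *)
Lemma crossing_terms_local_move (C : finType) (F : fieldType) (D E : diagram C) (x : C -> F)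
    S u l r v :
  is_tangle_diagram D -> is_tangle_diagram E -> dtop D = dtop E ->
  dword D = u ++ l ++ v -> dword E = u ++ r ++ v -> run (dtop D) u = Some S ->
  local_move l r ->
  \sum_(j < size l) crossing_term D x (size u + j) =
  \sum_(j < size r) crossing_term E x (size u + j)
  /\ step_equiv S (unmarked l) (unmarked r).
Proof.
move=> tD tE DE wD wE uS lr.
have [B1 vl] : exists B1, run S l = Some B1.
  case: (tD) => + _ _; rewrite wD run_cat uS /= run_cat.
  by case: (run S l) => // B1; exists B1.
have [B2 vr] : exists B2, run S r = Some B2.
  case: (tE) => + _ _; rewrite wE -DE run_cat uS /= run_cat.
  by case: (run S r) => // B2; exists B2.
have same j j' (jl : (j < size l)%N) (jr : (j' < size r)%N)
    (H : forall e, step_equiv S (mark j e l) (mark j' e r)) :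
    crossing_term E x (size u + j') = crossing_term D x (size u + j).
  rewrite -[RHS]mul1r.
  apply: (crossing_term_local x tD tE DE wD wE uS jl jr (sg := 1)) => // e.
  by rewrite mul1r.
have D0 j i t := @crossing_term_extremum C F D x u l v j i t wD.
have E0 j i t := @crossing_term_extremum C F E x u r v j i t wE.
have low i l0 r0 : (i <= size S)%N ->
    step_equiv (drop i S) (unmarked l0) (unmarked r0) ->
    step_equiv S (unmarked (shift_layers i l0)) (unmarked (shift_layers i r0)).
  by rewrite !unmarked_shift; apply: step_equiv_shift.
have lowm i j j' e l0 r0 : (i <= size S)%N ->
    step_equiv (drop i S) (mark j e l0) (mark j' e r0) ->
    step_equiv S (mark j e (shift_layers i l0)) (mark j' e (shift_layers i r0)).
  by rewrite !mark_shift; apply: step_equiv_shift.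
have iS i t w B : run S ((i, t) :: w) = Some B -> (i <= size S)%N.
  by move/layer_out_size; apply: leq_trans; rewrite leq_addr.
case: lr vl vr same D0 E0 wD wE => [i j a b ij|i s|i s|i c|i s c|i c|i s c|i c|i c1 c2 c3 adm];
  move=> vl vr same D0 E0 wD wE; rewrite /= ?big_ord_recl ?big_ord0 /= ?addr0.
- rewrite (same 0 1) ?(same 1 0) //.
  + by rewrite addrC; split=> //; apply: exchange_equiv.
  + by move=> e; apply: exchange_equiv.
  + by move=> e; apply: exchange_equiv.
- rewrite (D0 0 _ _ erefl) // (D0 1 _ _ erefl) // addr0; split=> //.
  have Si := iS _ _ _ _ vl; move: vl; rewrite -(shift_layers01 i).
  move=> /(run_shift Si)[B' /zigzag_left_run[S' E']].
  by apply: (low i _ [::]); rewrite // E'; apply: zigzag_left_equiv.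
- rewrite (D0 0 _ _ erefl) // (D0 1 _ _ erefl) // addr0; split=> //.
  have Si := ltnW (iS _ _ _ _ vl); move: vl; rewrite -(shift_layers10 i).
  move=> /(run_shift Si)[B' /zigzag_right_run[S' E']].
  by apply: (low i _ [::]); rewrite // E'; apply: zigzag_right_equiv.
- have Si := iS _ _ _ _ vl.
  rewrite (same 0 0) // ?(D0 1 _ _ erefl) ?(E0 1 _ _ erefl) //; last first.
    move=> e; rewrite -(shift_layers01 i) -(shift_layers10 i).
    by apply: lowm => //; apply: slide_cup_equiv.
  split=> //; rewrite -(shift_layers01 i) -(shift_layers10 i).
  by apply: low => //; apply: slide_cup_equiv.
- have Si := iS _ _ _ _ vl.
  rewrite (same 1 1) // ?(D0 0 _ _ erefl) ?(E0 0 _ _ erefl) //; last first.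
    move=> e; rewrite -(shift_layers01 i) -(shift_layers10 i).
    by apply: lowm => //; apply: slide_cap_equiv.
  split=> //; rewrite -(shift_layers01 i) -(shift_layers10 i).
  by apply: low => //; apply: slide_cap_equiv.
- have Si := iS _ _ _ _ vl.
  rewrite (D0 1 _ _ erefl) // (E0 0 _ _ erefl) // addr0; split.
    apply: (crossing_term_isolated x tD wD _ uS) => //; rewrite -(shift_layers00 i).
    by apply: isolates_shift => //; apply: R1_cup_isolates.
  rewrite -(shift_layers00 i) -(shift_layers0 i).
  by apply: low => //; apply: R1_cup_equiv.
- have Si := iS _ _ _ _ vl.
  rewrite (D0 0 _ _ erefl) // (E0 0 _ _ erefl) // add0r; split.
    apply: (crossing_term_isolated x tD wD _ uS) => //; rewrite -(shift_layers00 i).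
    by apply: isolates_shift => //; apply: R1_cap_isolates.
  rewrite -(shift_layers00 i) -(shift_layers0 i).
  by apply: low => //; apply: R1_cap_equiv.
- have Si := iS _ _ _ _ vl; split.
    rewrite (crossing_term_local x tD tD erefl wD wD uS (j := 0) (j' := 1) (sg := -1)) //.
      by rewrite rmorphN rmorph1 mulN1r subrr.
    move=> e; rewrite mulN1r -(shift_layers00 i) !mark_shift.
    by apply: step_equiv_shift => //; apply: R2_marked_equiv.
  move: vl; rewrite -(shift_layers00 i).
  move=> /(run_shift Si)[B' /R2_run[a [b [S' E']]]].
  by apply: (low i _ [::]); rewrite // E'; apply: R2_equiv.
- have Si := iS _ _ _ _ vl.
  have lows e j j' : (forall S' : seq (strand C), step_equiv S'
      (mark j e [:: (0, Cross c1); (1, Cross c2); (0, Cross c3)])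
      (mark j' e [:: (1, Cross c3); (0, Cross c2); (1, Cross c1)])) ->
    step_equiv S (mark j e [:: (i, Cross c1); (i.+1, Cross c2); (i, Cross c3)])
      (mark j' e [:: (i.+1, Cross c3); (i, Cross c2); (i.+1, Cross c1)]).
    by rewrite -(shift_layers010 i) -(shift_layers101 i) => H; apply: lowm.
  rewrite -[bump 0 (bump 0 0)]/2%N -[bump 0 0]/1%N.
  rewrite (same 0 2) ?(same 1 1) ?(same 2 0) //; last first.
  + by move=> e; apply: lows => S'; apply: R3_marked1.
  + by move=> e; apply: lows => S'; apply: R3_marked2.
  + by move=> e; apply: lows => S'; apply: R3_marked3.
  split; first by rewrite addrC -addrA addrC -!addrA; congr (_ + _); rewrite addrC.
  rewrite -(shift_layers010 i) -(shift_layers101 i).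
  by apply: low => //; apply: R3_equiv.
Qed.

Lemma Wsc_move (C : finType) (F : fieldType) (D E : diagram C) (x : C -> F) :
  move D E -> Wsc D x = Wsc E x.
Proof.
move=> [tD tE DE _ [u [l [r [v [lr wD wE]]]]]].
have [S uS] : exists S, run (dtop D) u = Some S.
  case: (tD) => + _ _; rewrite wD run_cat.
  by case: (run _ u) => // S; exists S.
have [Esum H] := crossing_terms_local_move x tD tE DE wD wE uS lr.
rewrite !Wsc_crossing_terms wD wE !size_cat !big_split_ord /= Esum; congr (_ + (_ + _)).
  apply: eq_bigr => -[k ku] _ /=; rewrite -[LHS]mul1r; apply/esym.
  apply: (@crossing_term_context C F D E x S _ _ 1 (fun e => mark k e u) (fun=> unmarked l)
    (fun=> unmarked r) (fun=> unmarked v)) => //; rewrite ?wD ?wE ?size_cat ?ltn_addr //.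
  by move=> e; rewrite mul1r !mark_catl // !unmarked_cat unzip2_mark.
apply: eq_bigr => -[k kv] _ /=; rewrite -[LHS]mul1r; apply/esym.
apply: (@crossing_term_context C F D E x S _ _ 1 (fun=> unmarked u) (fun=> unmarked l)
    (fun=> unmarked r) (fun e => mark k e v)) => //;
  rewrite ?wD ?wE ?size_cat ?ltn_add2l //.
by move=> e; rewrite mul1r !mark_catr unzip2_unmarked.
Qed.

Lemma Wsc_same_tangle (C : finType) (F : fieldType) (D E : diagram C) (x : C -> F) :
  same_tangle D E -> Wsc D x = Wsc E x.
Proof.
elim=> [D1 E1 /Wsc_move|D1|D1 E1 _ ->|D1 E1 G _ -> _ ->] //; exact.
Qed.

(** * Renaming components *)

Definition relabel_marked (C C' : Type) (f : C -> C') (ml : marked_layer C) :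
    marked_layer C' :=
  (ml.1, relabel_layer f ml.2).

Definition relabel_coloured (C C' : Type) (f : C -> C') :
    strand (C * bool) -> strand (C' * bool) :=
  relabel_strand (fun cb => (f cb.1, cb.2)).

Lemma mark_relabel (C C' : Type) (f : C -> C') k e (w : seq (layer C)) :
  mark k e (map (relabel_layer f) w) = map (relabel_marked f) (mark k e w).
Proof.
elim: w k => [|l w IH] [|k] //=; last by rewrite IH.
by rewrite /unmarked -!map_comp.
Qed.

Lemma layer_out_relabel (C C' : eqType) (f : C -> C') l s s' :
  layer_out l s = Some s' ->
  layer_out (relabel_layer f l) (map (relabel_strand f) s) =
  Some (map (relabel_strand f) s').
Proof.
case: l => i t /layer_outP[p [a [q [b [/= sp -> -> tab]]]]].
apply/layer_outP; exists (map (relabel_strand f) p), (map (relabel_strand f) a).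
exists (map (relabel_strand f) q), (map (relabel_strand f) b).
rewrite size_map !map_cat; split=> //=.
case: t tab => [x||c]; case: a => [|y [|z [|? ?]]] //=.
- by move=> [<-].
- by case: eqP => // -> [<-]; rewrite eqxx.
- by move=> [<-].
Qed.

Lemma run_relabel (C C' : eqType) (f : C -> C') w s s' :
  run s w = Some s' ->
  run (map (relabel_strand f) s) (map (relabel_layer f) w) =
  Some (map (relabel_strand f) s').
Proof.
elim: w s => [|l w IH] s /=; first by move=> [->].
rewrite !run_cons; case E: (layer_out l s) => [s1|] //= /IH.
by rewrite (layer_out_relabel f E).
Qed.

Lemma forget_relabel (C C' : Type) (f : C -> C') s :
  map (@forget C') (map (relabel_coloured f) s) =
  map (relabel_strand f) (map (@forget C) s).
Proof. by rewrite -!map_comp. Qed.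

Lemma relabel_coloured_lift (C C' : Type) (f : C -> C') s S :
  map (@forget C') s = map (relabel_strand f) S ->
  exists s0, s = map (relabel_coloured f) s0 /\ map (@forget C) s0 = S.
Proof.
elim: s S => [|[d [c b]] s IH] [|[d' c'] S] //; first by exists [::].
move=> /= [-> -> /IH[s0 [-> <-]]].
by exists ((d', (c', b)) :: s0).
Qed.

Lemma pairing_relabel (C C' : eqType) (f : C -> C') i x y : injective f ->
  pairing (f i) (relabel_coloured f x) (relabel_coloured f y) = pairing i x y.
Proof. by move=> inj_f; rewrite /pairing /= !(inj_eq inj_f). Qed.

Lemma layer_step_relabel (C C' : eqType) (f : C -> C') i m l s s' n :
  injective f -> layer_step i m l s s' n ->
  layer_step (f i) m (relabel_layer f l)
    (map (relabel_coloured f) s) (map (relabel_coloured f) s') n.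
Proof.
move=> inj_f [p [q [a [b [sp -> -> H]]]]].
exists (map (relabel_coloured f) p), (map (relabel_coloured f) q).
exists (map (relabel_coloured f) a), (map (relabel_coloured f) b).
rewrite size_map !map_cat; split=> //=; move: H.
case: m l.2 => [e|] [x||[lo|]] //=;
  case: a => [|y [|z [|? ?]]] //; case: b => [|y' [|z' [|? ?]]] //=.
- by move=> [[-> -> -> ->] -> -> -> ->].
- by move=> [<- -> ->].
- by move=> [-> ->].
- by move=> [-> -> ->]; rewrite pairing_relabel.
- by move=> [-> -> ->].
Qed.

Lemma word_step_relabel (C C' : eqType) (f : C -> C') i w s s' n :
  injective f -> word_step i w s s' n ->
  word_step (f i) (map (relabel_marked f) w)
    (map (relabel_coloured f) s) (map (relabel_coloured f) s') n.
Proof.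
move=> inj_f; elim: w s n => [|[m l] w IH] s n; first by move=> [-> ->].
move=> /word_step_cons[s1 [n1 [n2 [H /IH H' ->]]]].
apply/word_step_cons; exists (map (relabel_coloured f) s1), n1, n2.
by split=> //; apply: layer_step_relabel.
Qed.

Lemma map_eq_cat (T T' : Type) (f : T -> T') s a b :
  map f s = a ++ b -> exists s1 s2, [/\ s = s1 ++ s2, map f s1 = a & map f s2 = b].
Proof.
elim: s a => [|x s IH] [|y a] //=.
- by move=> <-; exists [::], [::].
- by move=> <-; exists [::], (x :: s).
- by move=> [<- /IH[s1 [s2 [-> <- <-]]]]; exists (x :: s1), s2.
Qed.

(** The colours of renamed strands come from colours of the original ones. The
    equation [f i = c] is a hypothesis on [i] alone because it is known only
    after the marked crossing has been reached. *)
Lemma layer_step_lift (C C' : eqType) (f : C -> C') c m l s t n :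
  injective f ->
  layer_step c m (relabel_layer f l) (map (relabel_coloured f) s) t n ->
  exists s', t = map (relabel_coloured f) s' /\
    forall i, f i = c -> layer_step i m l s s' n.
Proof.
move=> inj_f [p [q [a [b [/= sp E -> H]]]]].
have [p0 [r [-> Ep]]] := map_eq_cat E.
move=> /map_eq_cat[a0 [q0 [-> Ea Eq]]].
suff [b0 [Eb H']] : exists b0, b = map (relabel_coloured f) b0 /\
    forall i, f i = c -> tile_step i m l.2 a0 b0 n.
  exists (p0 ++ b0 ++ q0); rewrite !map_cat Ep Eq Eb; split=> // i /H' Hi.
  by exists p0, q0, a0, b0; split=> //; rewrite -sp -Ep size_map.
rewrite -{}Ea in H; move: H.
case: m l.2 => [e|] [x||[lo|]] //=;
  case: a0 => [|y [|z [|? ?]]] //; case: b => [|y' [|z' [|? ?]]] //=.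
- move=> [[yc zc fy fz] -> -> -> ->].
  exists [:: flip_colour z; flip_colour y]; split=> // i ic; split=> //.
  by split=> //; apply: inj_f; rewrite ic.
- case: y' => [d [k o]] [[-> ->] -> ->].
  exists [:: (x.1, (x.2, o)); opp_strand (x.1, (x.2, o))]; split=> // i _.
  by split=> //; case: x.
- move=> [E' ->]; exists [::]; split=> // i _; split=> //.
  move: E'; case: y => [d [k o]]; case: z => [d' [k' o']] [-> /inj_f -> ->].
  by [].
- move=> [-> -> ->]; exists [:: z; y]; split=> // i <-.
  by split=> //; rewrite pairing_relabel.
- by move=> [-> -> ->]; exists [:: z; y].
Qed.

Lemma word_step_lift (C C' : eqType) (f : C -> C') c w s t n :
  injective f ->
  word_step c (map (relabel_marked f) w) (map (relabel_coloured f) s) t n ->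
  exists s', t = map (relabel_coloured f) s' /\
    forall i, f i = c -> word_step i w s s' n.
Proof.
move=> inj_f; elim: w s n => [|[m l] w IH] s n.
  by move=> [-> ->]; exists s.
move=> /word_step_cons[s1 [n1 [n2 [H W ->]]]].
have [s2 [E2 H2]] := layer_step_lift inj_f H.
move: W; rewrite E2 => /IH[s' [-> H']].
by exists s'; split=> // i ic; exists s2, n1, n2; split; [apply: H2|apply: H'|].
Qed.

(** The mark shows that [c] is the image of a component, which is what
    [word_step_lift] takes as given. *)
Lemma marked_component (C C' : eqType) (f : C -> C') c k e w s t n :
  injective f -> (k < size w)%N ->
  word_step c (mark k e (map (relabel_layer f) w)) (map (relabel_coloured f) s) t n ->
  exists i, f i = c.
Proof.
move=> inj_f; elim: w k s n => [|l w IH] [|k] s n // kw;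
  move=> /word_step_cons[s1 [n1 [n2 [H W _]]]]; last first.
  have [s2 [E2 _]] := layer_step_lift inj_f H.
  by move: W; rewrite E2; apply: IH.
move: H => [p [q [a [b [/= _ E _ H]]]]].
have [p0 [r [_ _]]] := map_eq_cat E.
move=> /map_eq_cat[a0 [q0 [_ Ea _]]]; rewrite -Ea in H.
case: l.2 H => [x||[lo|]] //=; case: a0 {Ea} => [|y [|z [|? ?]]] //=.
by case: b => [|y' [|z' [|? ?]]] //= [[<- _ _ _] _ _ _ _]; exists y.2.1.
Qed.

(** Where all strands belong to different components, colours can be read as a
    function of the component. This is how the absence of cups and caps is
    used. *)
Lemma colour_by_uniq (C : eqType) (s : seq (strand (C * bool))) :
  uniq (unzip2 (map (@forget C) s)) ->
  exists g, s = map (colour_by g) (map (@forget C) s).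
Proof.
elim: s => [|[d [c b]] s IH] /=; first by exists (fun=> false).
move=> /andP[cs /IH[g Eg]].
exists (fun c' => if c' == c then b else g c').
rewrite /colour_by /relabel_strand /= eqxx; congr (_ :: _).
rewrite {1}Eg; apply/eq_in_map => -[d' c'] /(map_f snd)/= c's.
rewrite /colour_by /relabel_strand /=; case: eqP => // Ec.
by rewrite -Ec c's in cs.
Qed.

(** * Connected sums *)

Lemma csum_component_lE (C C' : finType) (T : diagram C) (U : diagram C')
    (sigma : {i : C | long T i} -> {j : C' | long U j}) i :
  (exists H : long T i, csum_component_l sigma i = inr (val (sigma (Sub i H)))) \/
  (exists H : ~~ long T i, csum_component_l sigma i = inl (Sub i H)).
Proof.
rewrite /csum_component_l; case: {-}_ / boolP => H; [left|right]; by exists H.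
Qed.

Lemma csum_component_l_inj (C C' : finType) (T : diagram C) (U : diagram C')
    (sigma : {i : C | long T i} -> {j : C' | long U j}) :
  injective sigma -> injective (csum_component_l sigma).
Proof.
move=> inj i j.
case: (csum_component_lE sigma i) => -[H ->];
  case: (csum_component_lE sigma j) => -[H' ->] //.
- by move=> [/val_inj/inj/(congr1 val)].
- by move=> [].
Qed.

Lemma csum_component_l_closed (C C' : finType) (T : diagram C) (U : diagram C')
    (sigma : {i : C | long T i} -> {j : C' | long U j})
    (i : {i : C | ~~ long T i}) :
  csum_component_l sigma (val i) = inl i.
Proof.
case: (csum_component_lE sigma (val i)) => -[H ->].
  by have := valP i; rewrite H.
by congr inl; apply: val_inj.
Qed.

Lemma csum_component_l_long (C C' : finType) (T : diagram C) (U : diagram C')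
    (sigma : {i : C | long T i} -> {j : C' | long U j})
    (i : {i : C | long T i}) :
  csum_component_l sigma (val i) = inr (val (sigma i)).
Proof.
case: (csum_component_lE sigma (val i)) => -[H ->].
  by congr (inr (val (sigma _))); apply: val_inj.
by have := valP i; rewrite (negPf H).
Qed.

Lemma onth_unzip2_zip (A B : Type) (s : seq A) (t : seq B) m a b :
  onth (zip s t) m = Some (a, b) -> onth s m = Some a /\ onth t m = Some b.
Proof.
by elim: s t m => [|x s IH] [|y t] [|m] //=; [move=> [-> ->]|apply: IH].
Qed.

Lemma gluedP (C C' : eqType) (T : diagram C) (U : diagram C') i j :
  glued T U i j -> exists m, onth (unzip2 (dbot T)) m = Some i /\
                             onth (unzip2 (dtop U)) m = Some j.
Proof. by move=> /onthP[m mij]; exists m; apply: onth_unzip2_zip. Qed.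

Lemma respects_through_shift (C C' : Type) a k w i (t : tile C) (t' : tile C') 
    (f : point -> bool) :
  ntop t = ntop t' -> nbot t = nbot t' ->
  respects f (through_arcs (a + k) w (i, t)) =
  respects (fun z => f ((a + z.1)%N, z.2)) (through_arcs k w (i, t')).
Proof.
move=> E1 E2; rewrite /through_arcs !respects_cat /respects !all_map E1 E2.
by congr (_ && _); apply: eq_all => j /=; rewrite addnS.
Qed.

Lemma respects_tile_shift (C C' : Type) (g : C -> C') a k l (f : point -> bool) :
  respects f (tile_arcs (a + k) (relabel_layer g l)) =
  respects (fun z => f ((a + z.1)%N, z.2)) (tile_arcs k l).
Proof. by case: l => i [s||c]; rewrite /respects /= ?addnS. Qed.

Lemma respects_layer_shift (C C' : Type) (g : C -> C') a k w l (f : point -> bool) :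
  respects f (through_arcs (a + k) w (relabel_layer g l) ++
              tile_arcs (a + k) (relabel_layer g l)) =
  respects (fun z => f ((a + z.1)%N, z.2)) (through_arcs k w l ++ tile_arcs k l).
Proof.
rewrite [LHS]respects_cat [RHS]respects_cat respects_tile_shift; congr (_ && _).
case: l => i t; rewrite -[relabel_layer g (i, t)]/(i, (relabel_layer g (i, t)).2).
by apply: respects_through_shift; case: t.
Qed.

(** The bottom ends of [T] lie on different components, so the partner of each
    of them is determined by its component, and it is the one that [sigma]
    prescribes. *)
Lemma csum_interface (C C' : finType) (T : diagram C) (U : diagram C')
    (sigma : {i : C | long T i} -> {j : C' | long U j}) :
  csum_well_defined T U -> uniq (unzip2 (dbot T)) ->
  (forall i, glued T U (val i) (val (sigma i))) ->
  map (relabel_strand (csum_component_l sigma)) (dbot T) =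
  map (relabel_strand (csum_component_r T)) (dtop U).
Proof.
move=> wd uT glue; apply: eq_from_onth => m; rewrite !onth_map.
have E1 : onth (unzip1 (dbot T)) m = onth (unzip1 (dtop U)) m by rewrite wd.
rewrite !onth_map in E1.
case Et: (onth (dbot T) m) E1 => [[d i]|]; case Eu: (onth (dtop U) m) => [[d' j]|] //=.
move=> [<-]; congr Some; rewrite /relabel_strand /=; congr (_, _).
have iT : onth (unzip2 (dbot T)) m = Some i by rewrite onth_map Et.
have il : long T i.
  by rewrite /long /unzip2 map_cat mem_cat; apply/orP; right; apply/onthP; exists m.
rewrite -[i]/(val (Sub i il : {i : C | long T i})) csum_component_l_long.
have [m' [iT' jU]] := gluedP (glue (Sub i il)).
have Em : m = m'.
  apply: (onth_inj _ _ _ uT); last by rewrite iT iT'.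
  by rewrite gtn_min; apply/orP; left; apply/onth_size; exists i.
by move: jU; rewrite -Em onth_map Eu => -[->].
Qed.

Lemma run_csum (C C' : finType) (T : diagram C) (U : diagram C')
    (sigma : {i : C | long T i} -> {j : C' | long U j}) :
  run (dtop T) (dword T) = Some (dbot T) -> run (dtop U) (dword U) = Some (dbot U) ->
  map (relabel_strand (csum_component_l sigma)) (dbot T) =
  map (relabel_strand (csum_component_r T)) (dtop U) ->
  run (dtop (csum sigma)) (dword (csum sigma)) = Some (dbot (csum sigma)).
Proof.
move=> rT rU E; rewrite /csum /= run_cat (run_relabel _ rT) /= E.
exact: run_relabel.
Qed.

Lemma run_take (C : eqType) (S : seq (strand C)) w B k :
  run S w = Some B -> exists S', run S (take k w) = Some S'.
Proof.
rewrite -{1}(cat_take_drop k w) run_cat; case: (run S (take k w)) => // S' _.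
by exists S'.
Qed.

Lemma strands_at_csum_l (C C' : finType) (T : diagram C) (U : diagram C')
    (sigma : {i : C | long T i} -> {j : C' | long U j}) k :
  run (dtop T) (dword T) = Some (dbot T) -> (k <= size (dword T))%N ->
  strands_at (csum sigma) k =
  map (relabel_strand (csum_component_l sigma)) (strands_at T k).
Proof.
move=> rT kT; rewrite /strands_at /= takel_cat ?size_map // -map_take.
by have [S rS] := run_take k rT; rewrite (run_relabel _ rS) rS.
Qed.

Lemma strands_at_csum_r (C C' : finType) (T : diagram C) (U : diagram C')
    (sigma : {i : C | long T i} -> {j : C' | long U j}) k :
  run (dtop T) (dword T) = Some (dbot T) -> run (dtop U) (dword U) = Some (dbot U) ->
  map (relabel_strand (csum_component_l sigma)) (dbot T) =
  map (relabel_strand (csum_component_r T)) (dtop U) ->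
  strands_at (csum sigma) (size (dword T) + k) =
  map (relabel_strand (csum_component_r T)) (strands_at U k).
Proof.
move=> rT rU E; rewrite /strands_at /= take_cat size_map ltnNge leq_addr /= addKn.
rewrite run_cat (run_relabel _ rT) /= E -map_take.
by have [S rS] := run_take k rU; rewrite (run_relabel _ rS) rS.
Qed.

Lemma component_at_csum_l (C C' : finType) (T : diagram C) (U : diagram C')
    (sigma : {i : C | long T i} -> {j : C' | long U j}) k j :
  run (dtop T) (dword T) = Some (dbot T) -> (k <= size (dword T))%N ->
  component_at (csum sigma) (k, j) =
  omap (csum_component_l sigma) (component_at T (k, j)).
Proof.
move=> rT kT; rewrite /component_at /= strands_at_csum_l // !onth_map.
by case: (onth _ _).
Qed.

Lemma component_at_csum_r (C C' : finType) (T : diagram C) (U : diagram C')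
    (sigma : {i : C | long T i} -> {j : C' | long U j}) k j :
  run (dtop T) (dword T) = Some (dbot T) -> run (dtop U) (dword U) = Some (dbot U) ->
  map (relabel_strand (csum_component_l sigma)) (dbot T) =
  map (relabel_strand (csum_component_r T)) (dtop U) ->
  component_at (csum sigma) ((size (dword T) + k)%N, j) =
  omap (csum_component_r T) (component_at U (k, j)).
Proof.
move=> rT rU E; rewrite /component_at /= strands_at_csum_r // !onth_map.
by case: (onth _ _).
Qed.

Lemma points_le (C : eqType) (D : diagram C) p :
  p \in points D -> (p.1 <= size (dword D))%N /\ exists i, component_at D p = Some i.
Proof.
move=> /allpairsPdep[k [j [kD jD ->]]] /=; move: kD jD; rewrite !mem_iota /=.
move=> kD; rewrite add0n -(size_map snd) => /onth_size[i ij].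
by split=> //; exists i.
Qed.

(** A function constant along the arcs of the sum restricts to such functions
    on [T] and on [U]. It is therefore constant on the components of both, and
    the values on two glued components agree at a common endpoint. *)
Lemma csum_tangle (C C' : finType) (T : diagram C) (U : diagram C')
    (sigma : {i : C | long T i} -> {j : C' | long U j}) :
  is_tangle_diagram T -> is_tangle_diagram U -> injective sigma ->
  map (relabel_strand (csum_component_l sigma)) (dbot T) =
  map (relabel_strand (csum_component_r T)) (dtop U) ->
  (forall i, glued T U (val i) (val (sigma i))) ->
  is_tangle_diagram (csum sigma).
Proof.
move=> [rT pT cT] [rU pU cU] inj_s E glue.
have inj_l := csum_component_l_inj inj_s.
have size_csum : size (dword (csum sigma)) = (size (dword T) + size (dword U))%N.
  by rewrite size_cat !size_map.
have comp_l := component_at_csum_l sigma _ rT.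
have comp_r := component_at_csum_r _ _ rT rU E.
have inT p i : p \in points T -> component_at T p = Some i ->
    p \in points (csum sigma) /\
    component_at (csum sigma) p = Some (csum_component_l sigma i).
  case: p => k j /points_le[/= kT _] pi; have Ec := comp_l k j kT; rewrite pi in Ec.
  split=> //; apply: component_at_points Ec.
  by rewrite size_csum (leq_trans kT) ?leq_addr.
have inU k j i : (k, j) \in points U -> component_at U (k, j) = Some i ->
    ((size (dword T) + k)%N, j) \in points (csum sigma) /\
    component_at (csum sigma) ((size (dword T) + k)%N, j) = Some (inr i).
  move=> /points_le[/= kU _] pi; have Ec := comp_r k j; rewrite pi in Ec.
  split=> //; apply: component_at_points Ec.
  by rewrite size_csum leq_add2l.
split.
- exact: run_csum.
- case=> [i|j].
    have [p pP pi] := pT (val i); have [pS Ep] := inT p _ pP pi.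
    by exists p => //; rewrite Ep csum_component_l_closed.
  have [[k j'] pP pj] := pU j; have [pS Ep] := inU k j' _ pP pj.
  by exists ((size (dword T) + k)%N, j').
move=> p q pS qS pq; apply/joinedP => f /respects_arcs Hf.
pose fU (z : point) := f ((size (dword T) + z.1)%N, z.2).
have fT_r : respects f (arcs T None).
  apply/respects_arcs => k l kl.
  have kT : (k < size (dword T))%N by apply/onth_size; exists l.
  have := Hf k (relabel_layer (csum_component_l sigma) l).
  rewrite strands_at_csum_l // ?(ltnW kT) // size_map.
  rewrite -[k in respects f (through_arcs k _ (relabel_layer _ _) ++ tile_arcs k _)]add0n.
  rewrite respects_layer_shift /= onth_cat size_map kT onth_map kl.
  by move/(_ erefl); apply: etrans; apply: eq_all => -[[? ?] [? ?]].
have fU_r : respects fU (arcs U None).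
  apply/respects_arcs => k l kl.
  have := Hf (size (dword T) + k)%N (relabel_layer (csum_component_r T) l).
  rewrite strands_at_csum_r // size_map respects_layer_shift /=.
  rewrite onth_cat size_map ltnNge leq_addr /= addKn onth_map kl.
  by move/(_ erefl).
have inside_T a b i : a \in points T -> b \in points T ->
    component_at T a = Some i -> component_at T b = Some i -> f a = f b.
  by move=> aT bT ai bi; have /joinedP := cT a b aT bT (etrans ai (esym bi)); apply.
have inside_U a b i : a \in points U -> b \in points U ->
    component_at U a = Some i -> component_at U b = Some i -> fU a = fU b.
  by move=> aT bT ai bi; have /joinedP := cU a b aT bT (etrans ai (esym bi)); apply.
(* Both values are equal to the one at a common endpoint, number [m] on the line of gluing. *)
have across a b i j : a \in points T -> b \in points U ->
    component_at T a = Some i -> component_at U b = Some j ->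
    csum_component_l sigma i = inr j -> f a = fU b.
  move=> aT bU ai bj; case: (csum_component_lE sigma i) => -[H ->] // [Ej].
  have [m [mi mj]] := gluedP (glue (Sub i H)).
  have {}mj : onth (unzip2 (dtop U)) m = Some j by rewrite mj; congr Some.
  have Pm : component_at T (size (dword T), m) = Some i.
    by rewrite /component_at /= /strands_at take_size rT.
  have Qm : component_at U (0, m) = Some j.
    by rewrite /component_at /= /strands_at take0.
  rewrite (inside_T a (size (dword T), m) i) //; last exact: component_at_points Pm.
  rewrite -(inside_U (0, m) b j) //; last exact: component_at_points Qm.
  by rewrite /fU /= addn0.
have place a : a \in points (csum sigma) ->
    (exists i, [/\ a \in points T, component_at T a = Some i &
       component_at (csum sigma) a = Some (csum_component_l sigma i)]) \/
    (exists b j, [/\ b \in points U, component_at U b = Some j, f a = fU b &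
       component_at (csum sigma) a = Some (inr j)]).
  case: a => k j /points_le[/= kS [c Ec]]; rewrite size_csum in kS.
  have [kT|kT] := leqP k (size (dword T)).
    left; move: (Ec); rewrite comp_l //.
    case Ei: (component_at T (k, j)) => [i|] //= [Ec']; exists i.
    by split=> //; apply: component_at_points Ei.
  right; have Ek : k = (size (dword T) + (k - size (dword T)))%N by rewrite subnKC // ltnW.
  move: (Ec); rewrite {1}Ek comp_r.
  case Ei: (component_at U _) => [i|] //= [Ec']; exists (k - size (dword T), j)%N, i.
  split=> //; last by rewrite Ec -Ec'.
    by apply: component_at_points Ei; rewrite leq_subLR.
  by rewrite /fU /= -Ek.
have [[i [pT' pi Ep]]|[b [i [bU bi fb Ep]]]] := place p pS;
  have [[j [qT' qj Eq]]|[b' [j [bU' bj' fb' Eq]]]] := place q qS;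
  rewrite pq Eq in Ep; case: Ep => Eij.
- by apply: (inside_T _ _ i) => //; rewrite qj (inj_l _ _ Eij).
- by rewrite fb'; apply: across pT' bU' pi bj' (esym Eij).
- by rewrite fb; apply/esym/(across _ _ _ _ qT' bU qj bi Eij).
- by rewrite fb fb'; apply: (inside_U _ _ i) => //; rewrite bj' Eij.
Qed.

(** * Additivity *)

Lemma map_relabel_unzip2 (C C' : Type) (f : C -> C') s :
  unzip2 (map (relabel_strand f) s) = map f (unzip2 s).
Proof. by rewrite /unzip2 -!map_comp. Qed.

(** A colouring of the smoothing of [T] extends to the sum by giving to each
    component of [U] the colour of the bottom end of [T] glued to it; no two ends
    belong to the same component, and [U] adds no weight. Conversely a colouring
    of the sum restricts to [T]. The same holds for the crossings of [U], with
    the components of [T] coloured from below. *)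
Lemma Wsc_csum (C C' : finType) (F : fieldType) (T : diagram C) (U : diagram C')
    (sigma : {i : C | long T i} -> {j : C' | long U j})
    (y : csum_component C' T -> F) :
  is_tangle_diagram T -> is_tangle_diagram U ->
  csum_well_defined T U -> uniq (unzip2 (dbot T)) -> uniq (unzip2 (dtop U)) ->
  injective sigma -> (forall i, glued T U (val i) (val (sigma i))) ->
  Wsc (csum sigma) y =
  Wsc T (y \o csum_component_l sigma) + Wsc U (y \o csum_component_r T).
Proof.
move=> tT tU wd uT uU inj_s glue.
have E := csum_interface wd uT glue.
have tS := csum_tangle tT tU inj_s E glue.
have [rT _ _] := tT; have [rU _ _] := tU.
have inj_l := csum_component_l_inj inj_s.
have inj_r : injective (csum_component_r T : C' -> csum_component C' T) by move=> i j [].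
set l := csum_component_l sigma in E inj_l *; set r := csum_component_r T in E inj_r *.
have uE : uniq (unzip2 (map (relabel_strand l) (dbot T))).
  by rewrite map_relabel_unzip2 map_inj_uniq.
have runT := run_relabel l rT; have runU := run_relabel r rU.
rewrite !Wsc_crossing_terms /= size_cat !size_map big_split_ord /=; congr (_ + _).
  apply: eq_bigr => -[k kT] _ /=; rewrite -[RHS]mul1r.
  apply: (@crossing_term_transfer _ _ F T (csum sigma) l y k k 1) => //.
  - by rewrite /= size_cat !size_map ltn_addr.
  - move=> i e n [s [s' [Es W]]]; rewrite mul1r.
    have Es' : map (@forget C) s' = dbot T.
      by have := word_step_run W; rewrite unzip2_mark Es rT => -[].
    have [|g Eg] := @colour_by_uniq _ (map (relabel_coloured l) s').
      by rewrite forget_relabel Es'.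
    rewrite forget_relabel Es' E in Eg.
    exists (map (relabel_coloured l) s), (map (colour_by g) (map (relabel_strand r) (dbot U))).
    rewrite forget_relabel Es; split=> //=.
    rewrite mark_catl ?size_map //; apply/word_step_cat.
    exists (map (relabel_coloured l) s'), n, 0; rewrite addr0; split=> //.
      by rewrite mark_relabel; apply: word_step_relabel.
    by rewrite Eg; apply: word_step_components.
  - move=> c e n [s [s' [Es]]] /=; rewrite mark_catl ?size_map //.
    have [s0 [-> Es0]] := relabel_coloured_lift Es.
    move=> /word_step_cat[s1 [n1 [n2 [W _ _]]]].
    have [i ic] := marked_component inj_l kT W.
    rewrite mark_relabel in W; have [s2 [_ H]] := word_step_lift inj_l W.
    by exists i, e, n1, s0, s2; split=> //; apply: H.
apply: eq_bigr => -[k kU] _ /=; rewrite -[RHS]mul1r.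
apply: (@crossing_term_transfer _ _ F U (csum sigma) r y k _ 1) => //.
- by rewrite /= size_cat !size_map ltn_add2l.
- move=> j e n [s [s' [Es W]]]; rewrite mul1r.
  have [|g Eg] := @colour_by_uniq _ (map (relabel_coloured r) s).
    by rewrite forget_relabel Es -E.
  rewrite forget_relabel Es -E in Eg.
  exists (map (colour_by g) (map (relabel_strand l) (dtop T))), (map (relabel_coloured r) s').
  rewrite forget_colour_by; split=> //=.
  rewrite -(size_map (relabel_layer l) (dword T)) mark_catr; apply/word_step_cat.
  exists (map (relabel_coloured r) s), 0, n; rewrite add0r; split=> //.
    by rewrite Eg; apply: word_step_components.
  by rewrite mark_relabel; apply: word_step_relabel.
move=> c e n [s [s' [Es]]] /=.
rewrite -(size_map (relabel_layer l) (dword T)) mark_catr.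
move=> /word_step_cat[s1 [n1 [n2 [W1 W _]]]].
have Es1 : map (@forget _) s1 = map (relabel_strand r) (dtop U).
  by have := word_step_run W1; rewrite unzip2_unmarked Es runT E => -[].
have [s0 [Es01 Es0]] := relabel_coloured_lift Es1; rewrite Es01 in W.
have [i ic] := marked_component inj_r kU W.
rewrite mark_relabel in W; have [s2 [_ H]] := word_step_lift inj_r W.
by exists i, e, n2, s0, s2; split=> //; apply: H.
Qed.

(** * Laurent polynomials *)

Lemma is_laurent_poly N (p : {mpoly int[N]}) : is_laurent (tofrac p).
Proof. by exists p, 0%MM; rewrite mpolyX0 tofrac1 divr1. Qed.

Lemma tofrac_X_neq0 N (m : 'X_{1..N}) : tofrac ('X_[m] : {mpoly int[N]}) != 0.
Proof.
rewrite tofrac_eq0; apply/eqP => /(congr1 (mcoeff m)).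
by rewrite mcoeffX eqxx mcoeff0.
Qed.

Lemma is_laurentD N (f g : fraction_field N) :
  is_laurent f -> is_laurent g -> is_laurent (f + g).
Proof.
move=> [p [m ->]] [q [k ->]]; exists (p * 'X_[k] + q * 'X_[m]), (m + k)%MM.
by rewrite addf_div ?tofrac_X_neq0 // mpolyXD tofracD !tofracM.
Qed.

Lemma is_laurentM N (f g : fraction_field N) :
  is_laurent f -> is_laurent g -> is_laurent (f * g).
Proof.
move=> [p [m ->]] [q [k ->]]; exists (p * q), (m + k)%MM.
by rewrite mulf_div mpolyXD !tofracM.
Qed.

Lemma is_laurent_int N (z : int) : is_laurent (z%:~R : fraction_field N).
Proof.
have <- : tofrac (z%:~R : {mpoly int[N]}) = z%:~R :> fraction_field N.
  exact: rmorph_int.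
exact: is_laurent_poly.
Qed.

Lemma is_laurentB N (f g : fraction_field N) :
  is_laurent f -> is_laurent g -> is_laurent (f - g).
Proof.
move=> Hf Hg; rewrite -mulN1r; apply: is_laurentD => //; apply: is_laurentM => //.
exact: (is_laurent_int N (-1)).
Qed.

Lemma is_laurent_sum N (I : Type) (s : seq I) (P : pred I) (f : I -> fraction_field N) :
  (forall i, is_laurent (f i)) -> is_laurent (\sum_(i <- s | P i) f i).
Proof.
move=> H; elim/big_ind: _ => //; first exact: (is_laurent_int N 0).
exact: is_laurentD.
Qed.

Lemma is_laurent_varX N (i : 'I_N) (z : int) :
  is_laurent ((tofrac 'X_i : fraction_field N) ^ z).
Proof.
case: z => n; first by rewrite -exprnP -tofracXn; exact: is_laurent_poly.
rewrite NegzE -exprnN -tofracXn; exists 1, (U_(i) *+ n.+1)%MM.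
by rewrite mpolyXn tofrac1 div1r.
Qed.

Lemma subVr (F : fieldType) (s t : F) :
  s != 0 -> t != 0 -> s^-1 - t^-1 = - (s^-1 * t^-1 * (s - t)).
Proof. by move=> s0 t0; field; rewrite s0 t0. Qed.

(** For negative exponents, divide the equation for the opposite exponent by
    the powers of [x] and [y]. *)
Lemma laurent_subX N (i j : 'I_N) (z : int) :
  let x : fraction_field N := tofrac 'X_i in
  let y : fraction_field N := tofrac 'X_j in
  exists2 a, is_laurent a & x ^ z - y ^ z = a * (x - y).
Proof.
move=> x y.
have pos n : exists2 a, is_laurent a & x ^+ n - y ^+ n = a * (x - y).
  exists (\sum_(k < n) x ^+ (n.-1 - k) * y ^+ k).
    apply: is_laurent_sum => k.
    by apply: is_laurentM; rewrite -tofracXn; apply: is_laurent_poly.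
  by rewrite mulrC subrXX.
case: z => n; first exact: pos.
have [a la E] := pos n.+1; rewrite NegzE -!exprnN.
exists (- (x ^- n.+1 * y ^- n.+1 * a)).
  rewrite -mulN1r; apply: is_laurentM; first exact: (is_laurent_int N (-1)).
  apply: is_laurentM => //.
  by apply: is_laurentM; rewrite exprnN; apply: is_laurent_varX.
rewrite mulNr -(mulrA _ a) -E {E}; apply: subVr.
  exact: expf_neq0 (tofrac_X_neq0 _).
exact: expf_neq0 (tofrac_X_neq0 _).
Qed.

Lemma is_laurent_Wsc N (C : finType) (D : diagram C) (x : C -> fraction_field N) :
  (forall i z, is_laurent (x i ^ z)) -> is_laurent (Wsc D x).
Proof.
move=> H; rewrite /Wsc; do 2!(apply: is_laurent_sum => ?).
apply: is_laurentM; first exact: is_laurent_int.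
by apply: is_laurentB => //; apply: (is_laurent_int N 1).
Qed.

Lemma Wsc_sub (C : finType) (F : fieldType) (D : diagram C) (x y : C -> F) :
  Wsc D x - Wsc D y =
  \sum_i \sum_(c <- crossings D | (over_component c == i) && (under_component c == i))
    (sgn c)%:~R * (x i ^ smoothing_wriggle D c - y i ^ smoothing_wriggle D c).
Proof.
rewrite /Wsc -sumrB; apply: eq_bigr => i _; rewrite -sumrB.
by apply: eq_bigr => c _; rewrite -mulrBr opprB addrA subrK.
Qed.

Lemma addr_sub_cancel (V : zmodType) (a b c : V) : a + c - (b + c) = a - b.
Proof. by rewrite opprD addrACA subrr addr0. Qed.

Theorem proposition3p3p2 (n m : nat) (T : diagram 'I_n) (U : diagram 'I_m)
    (tangle_T : is_tangle_diagram T) (tangle_U : is_tangle_diagram U)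
    (sum_defined : csum_well_defined T U)
    (no_cup_cap_T : no_cups_or_caps T) (no_cup_cap_U : no_cups_or_caps U)
    (sigma : {i : 'I_n | long T i} -> {j : 'I_m | long U j})
    (sigma_bij : bijective sigma)
    (sigma_glues : forall i, glued T U (val i) (val (sigma i)))
    (TU : diagram (csum_component 'I_m T))
    (TU_sum : same_tangle TU (csum sigma)) :
  eq_mod_relations sigma
    (Wsc TU (csum_variable tvar uvar))
    (Wsc T tvar + Wsc U uvar).
Proof.
have [_ uT] := no_cup_cap_T; have [uU _] := no_cup_cap_U.
have add y := Wsc_csum y tangle_T tangle_U sum_defined uT uU
  (bij_inj sigma_bij) sigma_glues.
set y := csum_variable tvar uvar.
have ly c z : is_laurent (y c ^ z) by case: c => i; apply: is_laurent_varX.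
split.
- exact: is_laurent_Wsc.
- by apply: is_laurentD; apply: is_laurent_Wsc => i z; apply: is_laurent_varX.
rewrite (Wsc_same_tangle y TU_sum) add.
pose l := csum_component_l sigma.
pose d (i : 'I_n) : fraction_field (n + m) :=
  \sum_(c <- crossings T | (over_component c == i) && (under_component c == i))
    (sgn c)%:~R * (y (l i) ^ smoothing_wriggle T c - tvar i ^ smoothing_wriggle T c).
have d_closed i : ~~ long T i -> d i = 0.
  move=> Hi; rewrite /d big1 // => c _.
  rewrite -[i]/(val (Sub i Hi : {i : 'I_n | ~~ long T i})) /l csum_component_l_closed.
  by rewrite subrr mulr0.
have d_long (i : {i : 'I_n | long T i}) : exists a : fraction_field (n + m),
    is_laurent a /\ d (val i) = a * (tvar (val i) - uvar (val (sigma i))).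
  rewrite /d; elim/big_rec: _ => [|c b _ [a [la ->]]].
    by exists 0; split; [exact: (is_laurent_int _ 0)|rewrite mul0r].
  rewrite /l csum_component_l_long /=.
  have [a' la' E] := laurent_subX (lshift m (val i)) (rshift n (val (sigma i)))
    (smoothing_wriggle T c).
  exists (- (sgn c)%:~R * a' + a); split.
    apply: is_laurentD => //; apply: is_laurentM => //.
    by rewrite -rmorphN; apply: is_laurent_int.
  by rewrite mulrDl -mulrA -E mulNr -mulrN opprB.
have [a Ha] := fin_all_exists d_long.
exists a; split; first by move=> i; case: (Ha i).
have EU : Wsc U (y \o csum_component_r T) = Wsc U uvar by [].
rewrite EU addr_sub_cancel Wsc_sub.
rewrite (bigID (long T)) /= [X in _ + X]big1 ?addr0; last exact: d_closed.
rewrite -(eq_bigr _ (fun i _ => proj2 (Ha i))).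
exact: (big_sub (long T) d).
Qed.
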